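(* Let $G_{PC}=(V,E_{PC})$ be the partial correlation graph, $G_{GC}=(V,E_{GC})$ the causality graph, and $G_{GC}^a=(V,E_{GC}^a)$ the augmented causality graph for $\mathcal{Y}_V$ (see context). For $a,b\in V$ with $a\neq b$, the following are equivalent: (1) $a-b\notin E_{GC}^a$; (2) $\mathrm{dis}(\{a\}\cup\mathrm{ch}(a))\cap\mathrm{dis}(\{b\}\cup\mathrm{ch}(b))=\emptyset$ in $G_{GC}$; (3) $V\setminus\{a,b\}$ separates $\{a\}$ and $\{b\}$ in $G_{GC}^a$. In particular, this implies that $a-b\notin E_{PC}$, i.e. $E_{PC}\subseteq E_{GC}^a$.
   Context: $V=\{1,\dots,k\}$ and $\mathcal{Y}_V=(Y_V(t))_{t\in\mathbb{R}}$ is an $\mathbb{R}^k$-valued wide-sense stationary, mean-square continuous stochastic process with $\mathbb{E}[Y_V(t)]=0$ and a spectral density function $f_{Y_VY_V}$ (i.e. $\mathbb{E}[Y_V(t)Y_V(0)^\top]=\int_{-\infty}^\infty e^{i\lambda t}f_{Y_VY_V}(\lambda)\,d\lambda$) with $f_{Y_VY_V}(\lambda)>0$ (Hermitian positive definite) for all $\lambda\in\mathbb{R}$. For $A,B\subseteq V$, $f_{Y_AY_B}=[f_{Y_VY_V}]_{AB}$. It is also assumed that there is $0<\varepsilon<1$ such that $f_{Y_AY_A}(\lambda)^{-1/2}f_{Y_AY_B}(\lambda)f_{Y_BY_B}(\lambda)^{-1}f_{Y_BY_A}(\lambda)f_{Y_AY_A}(\lambda)^{-1/2}\le(1-\varepsilon)I_{|A|}$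 for almost all $\lambda\in\mathbb{R}$ and all disjoint nonempty $A,B\subseteq V$ (in the order of Hermitian matrices). Linear spaces: for $C\subseteq V$, $L_{Y_C}(t)$, $\mathcal{L}_{Y_C}(t)$, $\mathcal{L}_{Y_C}$ are the mean-square closures of the complex linear spans of $\{Y_c(t):c\in C\}$, $\{Y_c(s):c\in C,s\le t\}$, $\{Y_c(s):c\in C,s\in\mathbb{R}\}$, respectively ($\{0\}$ if $C=\emptyset$). $\mathcal{Y}_V$ is purely non-deterministic: $\bigcap_{t\in\mathbb{R}}\mathcal{L}_{Y_V}(t)=\{0\}$. For closed subspaces of $L^2(\mathbb{P})$, $\mathcal{L}_1\perp\mathcal{L}_2\mid\mathcal{L}_3$ means $\mathbb{E}[(X-P_{\mathcal{L}_3}X)\overline{(Z-P_{\mathcal{L}_3}Z)}]=0$ for all $X\in\mathcal{L}_1,Z\in\mathcal{L}_2$, where $P$ denotes orthogonal projection. Partial correlation graph: undirected graph on $V$ with, for $a\neq b$, $a-b\notin E_{PC}$ iff $\mathbb{E}[(Y_a(t)-P_{\mathcal{L}_{Y_{V\setminus\{a,b\}}}}Y_a(t))\overline{(Y_b(t)-P_{\mathcal{L}_{Y_{V\setminus\{a,b\}}}}Y_b(t))}]=0$ for all $t\in\mathbb{R}$ (the same time point $t$ in both factors), equivalently $L_{Y_a}(t)\perp L_{Y_b}(t)\mid\mathcal{L}_{Y_{V\setminus\{a,b\}}}$ for all $t\in\mathbb{R}$. Causality graph: mixed graph on $V$ with directed edges $\to$ and undirected (dashed) edges $--$, where for $a\ne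 b$: (i) $a\to b\notin E_{GC}$ iff $L_{Y_b}(t+h)\perp\mathcal{L}_{Y_a}(t)\mid\mathcal{L}_{Y_{V\setminus\{a\}}}(t)$ for all $0\le h\le1$, $t\in\mathbb{R}$; (ii) $a\,--\,b\notin E_{GC}$ iff $L_{Y_a}(t+h)\perp L_{Y_b}(t+h')\mid\mathcal{L}_{Y_V}(t)$ for all $0\le h,h'\le1$, $t\in\mathbb{R}$. (Several edges of different type between the same pair are possible; a path is a sequence of consecutively adjacent edges.) In a mixed graph, an intermediate vertex $c$ on a path is a collider if both edges of the path adjacent to it have an arrowhead or a dashed tail at $c$, i.e. $\to c\leftarrow$, $\to c\,--$, $--\,c\leftarrow$ or $--\,c\,--$. Two vertices are collider connected if they are connected by a path on which every intermediate vertex is a collider (a single edge is trivially such a path). The augmented graph $G^a=(V,E^a)$ of a mixed graph $G$ is the undirected graph with $a-b\notin E^a$ iff $a$ and $b$ are not collider connected in $G$. $\mathrm{ch}(a)=\{v\in V:a\to v\in E_{GC}\}$; $\mathrm{dis}(a)$ is the set consisting of $a$ and all $v\in V$ connected to $a$ by a path of dashed edges only; $\mathrm{dis}(A)=\bigcup_{a\in A}\mathrm{dis}(a)$. In an undirected graph, $C$ separates $A$ and $B$ if every path from an element of $A$ to an element of $B$ contains at least one vertex of $C$. *)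

(* Defs.v *)
From HB Require Import structures.
From mathcomp Require Import all_boot all_order all_algebra.
From mathcomp Require Import sesquilinear spectral complex.
From mathcomp Require Import all_classical all_reals all_analysis.

Set Implicit Arguments.
Unset Strict Implicit.
Unset Printing Implicit Defensive.

Import Order.TTheory GRing.Theory Num.Theory.
Import numFieldNormedType.Exports.

Local Open Scope classical_set_scope.
Local Open Scope complex_scope.
Local Open Scope ring_scope.
Local Open Scope sesquilinear_scope.

Section HermitianMatrices.
Context {R : realType}.
Implicit Type n : nat.

(* In [R[i]], [0 <= z] and [0 < z] entail that [z] is real. *)
Definition psdmx n (M : 'M[R[i]]_n) : Prop :=
  M \is hermsymmx /\ forall x : 'cV[R[i]]_n, 0 <= (x ^t* *m M *m x) 0 0.

Definition pdmx n (M : 'M[R[i]]_n) : Prop :=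
  M \is hermsymmx /\
  forall x : 'cV[R[i]]_n, x != 0 -> 0 < (x ^t* *m M *m x) 0 0.

Definition loewner_le n (M N : 'M[R[i]]_n) : Prop := psdmx (N - M).

(* A positive semidefinite matrix has exactly one positive semidefinite square
   root; on other matrices the value is irrelevant. *)
Definition sqrtmx n (M : 'M[R[i]]_n) : 'M[R[i]]_n :=
  xget 0 [set S : 'M[R[i]]_n | psdmx S /\ S *m S = M].

Definition invsqrtmx n (M : 'M[R[i]]_n) : 'M[R[i]]_n := sqrtmx (invmx M).

Definition blockmx k (M : 'M[R[i]]_k) (A B : {set 'I_k}) :
    'M[R[i]]_(#|A|, #|B|) :=
  mxsub (@enum_val _ (mem A)) (@enum_val _ (mem B)) M.

(* M_AA^{-1/2} M_AB M_BB^{-1} M_BA M_AA^{-1/2} *)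
Definition coherencemx k (M : 'M[R[i]]_k) (A B : {set 'I_k}) : 'M[R[i]]_#|A| :=
  invsqrtmx (blockmx M A A) *m blockmx M A B *m invmx (blockmx M B B)
    *m blockmx M B A *m invsqrtmx (blockmx M A A).

End HermitianMatrices.

Section ComplexIntegral.
Context {d : measure_display} {T : measurableType d} {R : realType}.

Definition cintegral (mu : {measure set T -> \bar R}) (g : T -> R[i]) : R[i] :=
  Rintegral mu setT (fun x => complex.Re (g x)) +i* Rintegral mu setT (fun x => complex.Im (g x)).

Definition cintegrable (mu : {measure set T -> \bar R}) (g : T -> R[i]) : Prop :=
  mu.-integrable setT (fun x => (complex.Re (g x))%:E) /\
  mu.-integrable setT (fun x => (complex.Im (g x))%:E).

End ComplexIntegral.

(* e^{i x} *)
Definition cis {R : realType} (x : R) : R[i] := cos x +i* sin x.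

(* Elements of L^2(P) are represented by functions; [cL2], [zero_space] and
   [ms_closure S] contain all the representatives of their elements. *)
Section ComplexL2.
Context {d : measure_display} {T : measurableType d} {R : realType}.
Variable P : probability T R.
Implicit Types (X Z : T -> R[i]) (S L : set (T -> R[i])).

Definition cL2 : set (T -> R[i]) :=
  [set X | (fun w => complex.Re (X w)) \in Lfun P 2%:E /\
           (fun w => complex.Im (X w)) \in Lfun P 2%:E].

Definition zero_space : set (T -> R[i]) :=
  [set X | cL2 X /\ {ae P, forall w, X w = 0}].

(* E[X conj(Z)] *)
Definition cinner X Z : R[i] := cintegral P (fun w => X w * (Z w)^*).

Definition cspan S : set (T -> R[i]) :=
  [set X | exists n (c : 'I_n -> R[i]) (Z : 'I_n -> T -> R[i]),
     (forall i, S (Z i)) /\ X = (fun w => \sum_(i < n) c i * Z i w)].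

Definition ms_closure S : set (T -> R[i]) :=
  [set X | cL2 X /\
     forall e : R, 0 < e ->
       exists2 Z, S Z &
         ('E_P[fun w => (Normc.normc (X w - Z w) ^+ 2)%R] < e%:E)%E].

Definition closed_span S : set (T -> R[i]) := ms_closure (cspan S).

(* A version of the orthogonal projection of [X] on the closed subspace [L]:
   the element of [L], unique up to almost sure equality, whose difference to
   [X] is orthogonal to [L]. *)
Definition proj L X : T -> R[i] :=
  xget (fun=> 0)
    [set X' | L X' /\ forall Z, L Z -> cinner (fun w => X w - X' w) Z = 0].

Definition resid L X : T -> R[i] := fun w => X w - proj L X w.

(* L1 _|_ L2 | L3 *)
Definition cond_orth (L1 L2 L3 : set (T -> R[i])) : Prop :=
  forall X Z, L1 X -> L2 Z -> cinner (resid L3 X) (resid L3 Z) = 0.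

Lemma cinnerC X Z : cinner Z X = (cinner X Z)^*.
Proof.
rewrite /cinner /cintegral /Rintegral; apply/eqP; rewrite eq_complex /=.
apply/andP; split; apply/eqP.
  congr fine; apply: eq_integral => w _; congr (_%:E).
  by case: (X w) (Z w) => a b [u v] /=; rewrite mulrC [b * - v]mulrN
    [v * - b]mulrN [v * b]mulrC.
have -> : (fun w => (complex.Im (Z w * (X w)^*))%:E) =
    (fun w => - (complex.Im (X w * (Z w)^*))%:E)%E.
  apply/funext => w; rewrite -EFinN; congr (_%:E).
  case: (X w) (Z w) => a b [u v] /=.
  by rewrite !mulrN opprD opprK [v * a]mulrC [u * b]mulrC addrC.
rewrite integralE [in RHS]integralE funeposN funenegN.
by case: (integral _ _ _) => [x||]; case: (integral _ _ _) => [y||] //=;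
  rewrite ?oppr0 // opprB.
Qed.

Lemma cond_orthC L1 L2 L3 : cond_orth L1 L2 L3 <-> cond_orth L2 L1 L3.
Proof.
by split=> H X Z LX LZ; rewrite cinnerC H // conjC0.
Qed.

End ComplexL2.

Section Processes.
Context {d : measure_display} {T : measurableType d} {R : realType}.
Context {P : probability T R} {k : nat}.
Variable Y : 'I_k -> R -> {RV P >-> R}.
Implicit Types (a b : 'I_k) (C : {set 'I_k}) (s t h : R).

Definition centered : Prop := forall a t, ('E_P[Y a t] = 0)%E.

Definition wide_sense_stationary : Prop :=
  [/\ forall a t, (Y a t : T -> R) \in Lfun P 2%:E,
      forall a s t, ('E_P[Y a s] = 'E_P[Y a t])%E &
      forall a b s t h,
        ('E_P[(Y a (s + h) \* Y b (t + h))%R] = 'E_P[(Y a s \* Y b t)%R])%E].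

Definition ms_continuous : Prop :=
  forall t : R,
    ('E_P[fun w => (\sum_a (Y a s w - Y a t w) ^+ 2)%R])%E @[s --> t] --> 0%E.

Definition spectral_density (f : R -> 'M[R[i]]_k) : Prop :=
  (forall a b, cintegrable lebesgue_measure (fun l => f l a b)) /\
  forall a b t,
    (fine ('E_P[(Y a t \* Y b 0)%R])%E)%:C =
    cintegral lebesgue_measure (fun l : R => cis (l * t) * f l a b).

Definition crv a t : T -> R[i] := fun w => (Y a t w)%:C.

(* The closed spans of the Y_c(s), c in C, with s = t, s <= t and s arbitrary. *)
Definition Lat C t : set (T -> R[i]) :=
  closed_span P [set crv c t | c in [set` C]].

Definition Lpast C t : set (T -> R[i]) :=
  closed_span P [set crv c s | c in [set` C] & s in [set s | s <= t]].

Definition Lall C : set (T -> R[i]) :=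
  closed_span P [set crv c s | c in [set` C] & s in [set: R]].

Definition purely_nondeterministic : Prop :=
  \bigcap_(t in [set: R]) Lpast [set: 'I_k]%SET t = zero_space P.

End Processes.

Record ugraph (V : finType) := UGraph {
  uedge :> rel V;
  uedge_sym : symmetric uedge;
  uedge_irr : irreflexive uedge }.

Record mgraph (V : finType) := MGraph {
  dedge : rel V;
  dashed : rel V;
  dedge_irr : irreflexive dedge;
  dashed_sym : symmetric dashed;
  dashed_irr : irreflexive dashed }.

Section UndirectedGraphs.
Context {V : finType}.

Definition separates (G : ugraph V) (C A B : {set V}) : Prop :=
  forall x p, x \in A -> last x p \in B -> path G x p ->
    has (mem C) (x :: p).

End UndirectedGraphs.

(* Edges as traversed by a path from [x] to [y]:
   x -> y, x <- y and x -- y, respectively. *)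
Variant ekind := Fwd | Bwd | Dash.

Section MixedGraphs.
Context {V : finType}.
Variable G : mgraph V.
Implicit Types (x y a b : V) (e : ekind) (p : seq (ekind * V)).

Definition estep e x y : bool :=
  match e with
  | Fwd => dedge G x y
  | Bwd => dedge G y x
  | Dash => dashed G x y
  end.

(* [e] has an arrowhead or a dashed tail at its second, resp. first, vertex. *)
Definition mark_tgt e : bool := if e is Bwd then false else true.
Definition mark_src e : bool := if e is Fwd then false else true.

(* A path is given by its first vertex and the sequence of its edges, each
   paired with the vertex it leads to; vertices may be repeated. *)
Fixpoint mpath x p : bool :=
  if p is (e, y) :: p' then estep e x y && mpath y p' else true.

Definition mlast x p : V := last x (map snd p).

Definition all_colliders p : bool :=
  sorted (fun e e' => mark_tgt e && mark_src e') (map fst p).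

Definition collider_connected a b : Prop :=
  exists p, [/\ mpath a p, mlast a p = b & all_colliders p].

Definition children a : {set V} := [set v | dedge G a v]%SET.

Definition dis a : {set V} := [set v | connect (dashed G) a v]%SET.

Definition Dis (A : {set V}) : {set V} := (\bigcup_(a in A) dis a)%SET.

Definition eflip e : ekind :=
  match e with Fwd => Bwd | Bwd => Fwd | Dash => Dash end.

Lemma estep_flip e x y : estep (eflip e) y x = estep e x y.
Proof. by case: e => //=; rewrite dashed_sym. Qed.

Lemma collider_connected_sym a b :
  collider_connected a b -> collider_connected b a.
Proof.
case=> p [pp <- cp].
suff [q [? ? ? _]] : exists q, [/\ mpath (mlast a p) q,
    mlast (mlast a p) q = a, all_colliders q &
    map fst q = map eflip (rev (map fst p))] by exists q.
elim/last_ind: p pp cp => [|p [e y] IH]; first by exists [::].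
have mpr z r : mpath z (rcons r (e, y)) = mpath z r && estep e (mlast z r) y.
  elim: r z => [z|[e' v'] r IHr z] /=; first by rewrite andbT.
  by rewrite IHr andbA.
rewrite mpr /all_colliders map_rcons -rev_sorted rev_rcons /=.
move=> /andP[pp ee] cp.
have cp' : all_colliders p by rewrite /all_colliders -rev_sorted (path_sorted cp).
have [q [q1 q2 q3 q4]] := IH pp cp'.
have lr : mlast a (rcons p (e, y)) = y by rewrite /mlast map_rcons last_rcons.
exists ((eflip e, mlast a p) :: q); rewrite lr; split => //=.
- by rewrite estep_flip ee.
- move: q3 cp; rewrite /all_colliders q4; case: (rev _) => //= e' r -> /andP[/andP[+ +] _].
  by case: (e) (e') => [] [].
- by rewrite q4.
Qed.

End MixedGraphs.

Program Definition augmented (V : finType) (G : mgraph V) : ugraph V :=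
  {| uedge := fun a b => (a != b) && `[< collider_connected G a b >] |}.
Next Obligation.
move=> V G a b; rewrite eq_sym; congr andb.
by apply/asboolP/asboolP; exact: collider_connected_sym.
Qed.
Next Obligation. by move=> V G a; rewrite eqxx. Qed.

Section ProcessGraphs.
Context {d : measure_display} {T : measurableType d} {R : realType}.
Context {P : probability T R} {k : nat}.
Variable Y : 'I_k -> R -> {RV P >-> R}.
Implicit Types (a b : 'I_k).

Definition partial_uncorrelated a b : Prop :=
  forall t : R,
    cinner P (resid P (Lall Y (~: [set a; b])%SET) (crv Y a t))
             (resid P (Lall Y (~: [set a; b])%SET) (crv Y b t)) = 0.

Definition granger_noncausal a b : Prop :=
  forall h t : R, 0 <= h <= 1 ->
    cond_orth P (Lat Y [set b]%SET (t + h)) (Lpast Y [set a]%SET t)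
      (Lpast Y (~: [set a])%SET t).

Definition contemp_uncorrelated a b : Prop :=
  forall h h' t : R, 0 <= h <= 1 -> 0 <= h' <= 1 ->
    cond_orth P (Lat Y [set a]%SET (t + h)) (Lat Y [set b]%SET (t + h'))
      (Lpast Y [set: 'I_k]%SET t).

Program Definition partial_correlation_graph : ugraph 'I_k :=
  {| uedge := fun a b => (a != b) && ~~ `[< partial_uncorrelated a b >] |}.
Next Obligation.
move=> a b; rewrite eq_sym; congr (_ && ~~ _).
by apply/asboolP/asboolP => H t; rewrite cinnerC finset.setUC H conjC0.
Qed.
Next Obligation. by move=> a; rewrite eqxx. Qed.

Program Definition causality_graph : mgraph 'I_k :=
  {| dedge := fun a b => (a != b) && ~~ `[< granger_noncausal a b >];
     dashed := fun a b => (a != b) && ~~ `[< contemp_uncorrelated a b >] |}.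
Next Obligation. by move=> a; rewrite eqxx. Qed.
Next Obligation.
move=> a b; rewrite eq_sym; congr (_ && ~~ _).
by apply/asboolP/asboolP => H h h' t h1 h'1; apply/cond_orthC; exact: H.
Qed.
Next Obligation. by move=> a; rewrite eqxx. Qed.

End ProcessGraphs.

(* Main.v *)
(* A collider path from a to b runs a -> or --, then through dashed edges only,
   then <- or -- b; so a and b are collider connected iff the districts of
   {a} u ch(a) and {b} u ch(b) meet.

   If they do not meet, let A be the union of the districts of {a} u ch(a), and
   let x be orthogonal to L_{V\a} and z to L_{V\b}.  The innovations
   Y_v(t+s) - P_{L_V(t)} Y_v(t+s) with v outside A lie in L_{V\a}, since a does
   not cause v; those with v in A lie in L_{V\b}; and the two families are
   orthogonal, since no dashed edge leaves A.  Hence the increment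
   P_{L_V(t+1)} x - P_{L_V(t)} x lies in the closed span of the innovations with
   v in A, to which z is orthogonal.  Summing over t, pure non-determinism gives
   <x, z> = 0.

   The coherence condition for {a} and V\{a} bounds the Schur complement of
   f_aa from below, so |u + w|^2 >= eps |u|^2 for u in L_a and w in L_{V\a};
   this yields that L_{V\a} and L_{V\b} intersect in L_{V\{a,b}}, and with it
   the orthogonality of the complements of L_{V\a} and L_{V\b} turns into that
   of the residuals of Y_a(t) and Y_b(t) given L_{V\{a,b}}. *)
Require Import Defs.
From HB Require Import structures.
From mathcomp Require Import all_boot all_order all_algebra.
From mathcomp Require Import sesquilinear spectral complex ring lra.
From mathcomp Require Import all_classical all_reals all_analysis measurable_realfun.

Set Implicit Arguments.
Unset Strict Implicit.
Unset Printing Implicit Defensive.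

Import Order.TTheory GRing.Theory Num.Theory.
Import numFieldNormedType.Exports.

Local Open Scope complex_scope.
Local Open Scope ring_scope.
Local Open Scope classical_set_scope.

(** * Complete semi-inner product spaces *)

Section ReIm.
Context {R : realType}.
Implicit Types z w : R[i].

Lemma ReD z w : complex.Re (z + w) = complex.Re z + complex.Re w.
Proof. by case: z w => a b []. Qed.
Lemma ImD z w : complex.Im (z + w) = complex.Im z + complex.Im w.
Proof. by case: z w => a b []. Qed.
Lemma ReN z : complex.Re (- z) = - complex.Re z.
Proof. by case: z. Qed.
Lemma ImN z : complex.Im (- z) = - complex.Im z.
Proof. by case: z. Qed.
Lemma ReM z w : complex.Re (z * w) =
  complex.Re z * complex.Re w - complex.Im z * complex.Im w.
Proof. by case: z w => a b []. Qed.
Lemma ImM z w : complex.Im (z * w) =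
  complex.Re z * complex.Im w + complex.Im z * complex.Re w.
Proof. by case: z w => a b []. Qed.
Lemma ReJ z : complex.Re z^* = complex.Re z.
Proof. by case: z. Qed.
Lemma ImJ z : complex.Im z^* = - complex.Im z.
Proof. by case: z. Qed.
Definition ReImE := (ReD, ImD, ReN, ImN, ReM, ImM, ReJ, ImJ).

Lemma complexP z w :
  complex.Re z = complex.Re w -> complex.Im z = complex.Im w -> z = w.
Proof. by case: z w => a b [c e] /= -> ->. Qed.

End ReIm.

(** The form is only semi-definite because random variables are kept as functions: nonzero vectors
    can have seminorm zero, so limits and projections are unique only up to such null vectors. *)
Record semihilbert (R : realType) (V : lmodType R[i]) := Semihilbert {
  ip :> V -> V -> R[i];
  ip_linear : forall a x y z, ip (a *: x + y) z = a * ip x z + ip y z;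
  ip_conj : forall x y, ip y x = (ip x y)^*;
  ip_ge0 : forall x, 0 <= complex.Re (ip x x);
  ip_complete : forall u : nat -> V,
    (forall e : R, 0 < e -> exists N, forall m n, (N <= m)%N -> (N <= n)%N ->
       complex.Re (ip (u m - u n) (u m - u n)) < e) ->
    exists x, forall e : R, 0 < e -> exists N, forall n, (N <= n)%N ->
       complex.Re (ip (x - u n) (x - u n)) < e }.

Section Semihilbert.
Context {R : realType} {V : lmodType R[i]} (h : semihilbert V).
Implicit Types (x y z p q : V) (L G : set V) (e : R).

Definition rip x y : R := complex.Re (h x y).
Definition nrm2 x : R := rip x x.

Lemma ipDl x y z : h (x + y) z = h x z + h y z.
Proof. by rewrite -[x]scale1r ip_linear mul1r scale1r. Qed.

Lemma ip0l z : h 0 z = 0.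
Proof. by apply: (addrI (h 0 z)); rewrite -ipDl !addr0. Qed.

Lemma ipZl a x z : h (a *: x) z = a * h x z.
Proof. by rewrite -[a *: x]addr0 ip_linear ip0l addr0. Qed.

Lemma ipNl x z : h (- x) z = - h x z.
Proof. by rewrite -scaleN1r ipZl mulN1r. Qed.

Lemma ipBl x y z : h (x - y) z = h x z - h y z.
Proof. by rewrite ipDl ipNl. Qed.

Lemma ipDr x y z : h z (x + y) = h z x + h z y.
Proof. by rewrite ip_conj ipDl rmorphD /= -!ip_conj. Qed.

Lemma ipZr a x z : h z (a *: x) = a^* * h z x.
Proof. by rewrite ip_conj ipZl rmorphM /= -!ip_conj. Qed.

Lemma ipNr x z : h z (- x) = - h z x.
Proof. by rewrite ip_conj ipNl rmorphN /= -!ip_conj. Qed.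

Lemma ip_eq0C x y : h x y = 0 -> h y x = 0.
Proof. by move=> H; rewrite ip_conj H conjC0. Qed.

Lemma ripC x y : rip x y = rip y x.
Proof. by rewrite /rip ip_conj ReJ. Qed.
Lemma ripDl x y z : rip (x + y) z = rip x z + rip y z.
Proof. by rewrite /rip ipDl ReD. Qed.
Lemma ripNl x z : rip (- x) z = - rip x z.
Proof. by rewrite /rip ipNl ReN. Qed.
Lemma ripDr x y z : rip z (x + y) = rip z x + rip z y.
Proof. by rewrite ripC ripDl !(ripC _ z). Qed.
Lemma ripNr x z : rip z (- x) = - rip z x.
Proof. by rewrite ripC ripNl (ripC z). Qed.
Lemma ripZl (a : R) x z : rip (a%:C *: x) z = a * rip x z.
Proof. by rewrite /rip ipZl ReM /= mul0r subr0. Qed.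
Lemma ripZr (a : R) x z : rip z (a%:C *: x) = a * rip z x.
Proof. by rewrite ripC ripZl (ripC z). Qed.
Definition ripE := (ripDl, ripDr, ripNl, ripNr, ripZl, ripZr).

Lemma nrm2_ge0 x : 0 <= nrm2 x.
Proof. exact: ip_ge0. Qed.
Hint Resolve nrm2_ge0 : core.

Lemma nrm2N x : nrm2 (- x) = nrm2 x.
Proof. by rewrite /nrm2 !ripE opprK. Qed.

Lemma nrm2BC x y : nrm2 (x - y) = nrm2 (y - x).
Proof. by rewrite -nrm2N opprB. Qed.

Lemma nrm20 : nrm2 0 = 0.
Proof. by rewrite /nrm2 /rip ip0l. Qed.

Lemma nrm2D_le x y : nrm2 (x + y) <= 2 * (nrm2 x + nrm2 y).
Proof.
have := nrm2_ge0 (x - y); rewrite /nrm2 !ripE (ripC y x); lra.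
Qed.

(* A quadratic in the real variable [r], taken at its minimum [r = rip x y / nrm2 y]. *)
Lemma near_minimizer_rip x y (d : R) :
  (forall r : R, nrm2 x - d <= nrm2 (x - r%:C *: y)) ->
  rip x y ^+ 2 <= d * nrm2 y.
Proof.
move=> H.
have H' r : 2 * r * rip x y <= d + r ^+ 2 * nrm2 y.
  have := H r; rewrite /nrm2 !ripE (ripC y x) expr2; lra.
have := nrm2_ge0 y; rewrite le_eqVlt => /orP[/eqP n0|n0].
  rewrite -n0 mulr0; have [->|s0] := eqVneq (rip x y) 0; first by rewrite expr0n.
  have := H' ((d + 1) / (2 * rip x y)); rewrite -n0 mulr0.
  have -> : 2 * ((d + 1) / (2 * rip x y)) * rip x y = d + 1 by field.
  lra.
have := H' (rip x y / nrm2 y).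
have -> : 2 * (rip x y / nrm2 y) * rip x y = 2 * (rip x y ^+ 2 / nrm2 y).
  by field; apply: lt0r_neq0.
have -> : (rip x y / nrm2 y) ^+ 2 * nrm2 y = rip x y ^+ 2 / nrm2 y.
  by field; apply: lt0r_neq0.
by move=> H2; rewrite -ler_pdivrMr//; lra.
Qed.

Lemma cauchy_schwarz x y : rip x y ^+ 2 <= nrm2 x * nrm2 y.
Proof. by apply: near_minimizer_rip => r; rewrite subrr. Qed.

Lemma nrm2_eq0_rip x y : nrm2 x = 0 -> rip x y = 0.
Proof.
move=> x0; apply/eqP; rewrite -sqrf_eq0 eq_le sqr_ge0 andbT.
by rewrite (le_trans (cauchy_schwarz _ _))// x0 mul0r.
Qed.

Lemma nrm2Z a x : nrm2 (a *: x) = (complex.Re a ^+ 2 + complex.Im a ^+ 2) * nrm2 x.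
Proof.
by rewrite /nrm2 /rip ipZl ipZr mulrA !ReImE; ring.
Qed.

(** Multiplying [x] by [-i] turns the imaginary part of [h x y] into a real part. Orthogonality can
    therefore be proved with the real form [rip]. *)
Lemma rip_ip0 x y : (forall a, rip (a *: x) y = 0) -> h x y = 0.
Proof.
move=> H; apply: complexP; first by have := H 1; rewrite scale1r.
have := H (0 -i* 1); rewrite /rip ipZl ReM /=; lra.
Qed.

Lemma nrm2_eq0_ip x y : nrm2 x = 0 -> h x y = 0.
Proof.
move=> x0; apply: rip_ip0 => a; apply: nrm2_eq0_rip.
by rewrite nrm2Z x0 mulr0.
Qed.

Lemma rip_approx0 x y (C : R) :
  (forall e, 0 < e -> rip x y ^+ 2 <= e * C) -> rip x y = 0.
Proof.
move=> H; apply/eqP; rewrite -sqrf_eq0 eq_le sqr_ge0 andbT.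
rewrite leNgt; apply/negP => p0.
have C0 : 0 < C.
  by have := H 1 ltr01; rewrite mul1r; apply: lt_le_trans.
have := H (rip x y ^+ 2 / (2 * C)) (divr_gt0 p0 (mulr_gt0 (ltr0Sn _ 1) C0)).
have -> : rip x y ^+ 2 / (2 * C) * C = rip x y ^+ 2 / 2.
  by field; apply: lt0r_neq0.
lra.
Qed.

(** Closedness is tested with the seminorm, so a closed subspace contains every vector at distance
    zero from one of its elements ([cs_null]). *)
Definition closed_subspace L :=
  [/\ L 0, forall a x y, L x -> L y -> L (a *: x + y) &
      forall x, (forall e, 0 < e -> exists2 z, L z & nrm2 (x - z) < e) -> L x].

Definition perp x L := forall z, L z -> h x z = 0.

Definition is_proj L x p := L p /\ perp (x - p) L.

Definition lspan G : set V :=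
  [set x | exists n (c : 'I_n -> R[i]) (u : 'I_n -> V),
     (forall i, G (u i)) /\ x = \sum_(i < n) c i *: u i].

Definition clspan G : set V :=
  [set x | forall e, 0 < e -> exists2 z, lspan G z & nrm2 (x - z) < e].

(** * Orthogonal projection on a closed subspace *)

Section ClosedSubspace.
Variables (L : set V) (cL : closed_subspace L).

Lemma cs0 : L 0. Proof. by case: cL. Qed.
Lemma csD x y : L x -> L y -> L (x + y).
Proof. by case: cL => _ H _ Lx Ly; rewrite -[x]scale1r; apply: H. Qed.
Lemma csZ a x : L x -> L (a *: x).
Proof. by case: cL => L0 H _ Lx; rewrite -[_ *: _]addr0; apply: H. Qed.
Lemma csN x : L x -> L (- x).
Proof. by move=> Lx; rewrite -scaleN1r; apply: csZ. Qed.
Lemma csB x y : L x -> L y -> L (x - y).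
Proof. by move=> Lx Ly; apply: csD => //; apply: csN. Qed.

Lemma cs_null x y : L x -> nrm2 (y - x) = 0 -> L y.
Proof. by move=> Lx n0; case: cL => _ _; apply=> e e0; exists x; rewrite ?n0. Qed.

Lemma cs_sum n (c : 'I_n -> R[i]) (u : 'I_n -> V) :
  (forall i, L (u i)) -> L (\sum_(i < n) c i *: u i).
Proof.
by move=> Lu; elim/big_ind: _ => [||]; [exact: cs0|exact: csD|move=> i _; exact: csZ].
Qed.

Lemma lspan_cs G : G `<=` L -> lspan G `<=` L.
Proof. by move=> GL x [n [c [u [Gu ->]]]]; apply: cs_sum => i; apply: GL. Qed.

Lemma clspan_cs G : G `<=` L -> clspan G `<=` L.
Proof.
move=> GL x Hx; case: cL => _ _; apply=> e /Hx[z Gz xz].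
by exists z => //; apply: lspan_cs Gz.
Qed.

Lemma perp_rip x : (forall z, L z -> rip x z = 0) -> perp x L.
Proof.
move=> H z Lz; apply: ip_eq0C; apply: rip_ip0 => a; rewrite ripC; apply: H.
exact: csZ.
Qed.

(** A sequence in [L] minimizing the distance to [x] is Cauchy by the parallelogram law; its limit
    [p] is the projection because near-minimality forces [x - u n] to be almost orthogonal to
    [L]. *)
Lemma projection x : exists p, is_proj L x p.
Proof.
pose S := [set nrm2 (x - z) | z in L].
have hS : has_inf S.
  by split; [exists (nrm2 (x - 0)); exists 0 => //; exact: cs0|exists 0 => _ [z _ <-]].
pose dd := inf S.
have dle z : L z -> dd <= nrm2 (x - z).
  by move=> Lz; apply: ge_inf; [case: hS|exists z].
have near e : 0 < e -> exists2 z, L z & nrm2 (x - z) < dd + e.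
  by move=> e0; have [_ [z Lz <-] zl] := inf_adherent e0 hS; exists z.
have inv_gt0 n : 0 < n.+1%:R^-1 :> R by rewrite invr_gt0 ltr0Sn.
pose u n := projT1 (cid2 (near _ (inv_gt0 n))).
have Lu n : L (u n) by rewrite /u; case: cid2.
have un n : nrm2 (x - u n) < dd + n.+1%:R^-1 by rewrite /u; case: cid2.
have arch e : 0 < e -> exists N, forall n, (N <= n)%N -> n.+1%:R^-1 < e :> R.
  move=> e0; exists (Num.truncn e^-1) => n Nn.
  rewrite invf_plt ?posrE ?ltr0Sn//.
  by rewrite (lt_le_trans (truncnS_gt _))// ler_nat ltnS.
have cauchy : forall e, 0 < e -> exists N, forall m n, (N <= m)%N -> (N <= n)%N ->
    nrm2 (u m - u n) < e.
  (* The parallelogram law with the midpoint of [u m] and [u n], at squared distance at least [dd]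
     from [x], bounds [nrm2 (u m - u n)] by twice the sum of the two excesses over [dd], each below
     [e / 4]. *)
  move=> e e0; have [N HN] := arch (e / 4) (divr_gt0 e0 (ltr0Sn _ _)).
  exists N => m n Nm Nn.
  have mid := dle ((2^-1 : R)%:C *: (u m + u n)) (csZ _ (csD (Lu m) (Lu n))).
  have := un m; have := un n; have := HN _ Nm; have := HN _ Nn; move: mid.
  rewrite /nrm2 !ripE (ripC (u m) x) (ripC (u n) x) (ripC (u n) (u m)).
  move: n.+1%:R^-1 m.+1%:R^-1 => r1 r2; lra.
have [p hp] := ip_complete cauchy.
have Lp : L p.
  case: cL => _ _; apply=> e /hp[N HN]; exists (u N) => //.
  exact: HN.
exists p; split=> //; apply: perp_rip => z Lz.
(* Here [x - p] is [x - u n] minus [p - u n]. The product of [z] with either has square at most [e]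
   times [nrm2 z], by near-minimality and by Cauchy-Schwarz; the square of a difference is at most
   twice the sum of the squares, whence the 4. *)
apply: (@rip_approx0 _ _ (4 * nrm2 z)) => e e0.
have [N1 H1] := arch e e0; have [N2 H2] := hp e e0.
pose n := maxn N1 N2.
have xu : rip (x - u n) z ^+ 2 <= n.+1%:R^-1 * nrm2 z.
  apply: near_minimizer_rip => r.
  have := dle (u n + r%:C *: z) (csD (Lu n) (csZ _ Lz)).
  rewrite opprD addrA => ?; have := un n; move: n.+1%:R^-1 => r1; lra.
have up : rip (p - u n) z ^+ 2 <= e * nrm2 z.
  apply: le_trans (cauchy_schwarz _ _) _; rewrite ler_wpM2r//.
  by apply: ltW; apply: H2; rewrite leq_maxr.
have ue : n.+1%:R^-1 * nrm2 z <= e * nrm2 z.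
  by rewrite ler_wpM2r//; apply: ltW; apply: H1; rewrite leq_maxl.
have -> : x - p = (x - u n) - (p - u n) by rewrite opprB addrA addrNK.
rewrite ripDl ripNl.
have := sqr_ge0 (rip (x - u n) z + rip (p - u n) z).
have := le_trans xu ue; move: up; move: (rip (x - u n) z) (rip (p - u n) z) => r1 r2.
rewrite !expr2; lra.
Qed.

Lemma is_proj_uniq x p q : is_proj L x p -> is_proj L x q -> nrm2 (p - q) = 0.
Proof.
move=> [Lp xp] [Lq xq]; rewrite /nrm2 /rip.
have -> : h (p - q) (p - q) = h (x - q) (p - q) - h (x - p) (p - q).
  by rewrite -ipBl; congr (h _ _); rewrite opprB [RHS]addrC addrA addrNK.
by rewrite xq ?xp ?subrr//; exact: csB.
Qed.

End ClosedSubspace.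

Lemma nrm2_pyth x y : h x y = 0 -> nrm2 (x + y) = nrm2 x + nrm2 y.
Proof.
move=> xy; rewrite /nrm2 !ripE (ripC y x); have -> : rip x y = 0 by rewrite /rip xy.
lra.
Qed.

Lemma lspan0 G : lspan G 0.
Proof.
by exists 0%N, (fun=> 0), (fun=> 0); split; [case|rewrite big_ord0].
Qed.

Lemma lspan_lin G a x y : lspan G x -> lspan G y -> lspan G (a *: x + y).
Proof.
move=> [n [c [u [Gu ->]]]] [m [d [v [Gv ->]]]].
exists (n + m)%N,
  (fun i => match fintype.split i with inl j => a * c j | inr j => d j end),
  (fun i => match fintype.split i with inl j => u j | inr j => v j end); split.
  by move=> i; case: (fintype.split i).
rewrite big_split_ord /= scaler_sumr; congr (_ + _); apply: eq_bigr => i _.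
  by case: splitP => [j /= /val_inj <-|j /= H]; [rewrite scalerA|
    have := ltn_ord i; rewrite H ltnNge leq_addr].
by case: splitP => [j /= H|j /= /addnI /val_inj <-//];
  have := ltn_ord j; rewrite -H ltnNge leq_addr.
Qed.

Lemma clspan_closed G : closed_subspace (clspan G).
Proof.
have sub : lspan G `<=` clspan G.
  by move=> x Gx e e0; exists x; rewrite // subrr nrm20.
split; first exact: sub (lspan0 G).
  move=> a x y Hx Hy e e0.
  pose s := complex.Re a ^+ 2 + complex.Im a ^+ 2.
  have s0 : 0 <= s by rewrite addr_ge0 ?sqr_ge0.
  (* With [s + 1] in place of [s] the denominator stays positive when [a = 0]. *)
  have e1 : 0 < e / (4 * (s + 1)) by rewrite divr_gt0// mulr_gt0//; lra.
  have [x' Gx xx] := Hx _ e1; have e4 : 0 < e / 4 by lra.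
  have [y' Gy yy] := Hy _ e4.
  exists (a *: x' + y'); first exact: lspan_lin.
  have -> : a *: x + y - (a *: x' + y') = a *: (x - x') + (y - y').
    by rewrite scalerBr opprD addrACA.
  apply: le_lt_trans (nrm2D_le _ _) _; rewrite nrm2Z -/s.
  have : s * nrm2 (x - x') <= e / 4.
    apply: (@le_trans _ _ ((s + 1) * (e / (4 * (s + 1))))).
      by apply: ler_pM => //; [lra|exact: ltW].
    by have -> : (s + 1) * (e / (4 * (s + 1))) = e / 4 by field; lra.
  lra.
move=> x Hx e e0; have e4 : 0 < e / 4 by lra.
have [z Hz xz] := Hx _ e4; have [w Gw zw] := Hz _ e4.
exists w => //; have -> : x - w = (x - z) + (z - w) by rewrite addrA addrNK.
by have := nrm2D_le (x - z) (z - w); lra.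
Qed.

Lemma sub_clspan G : G `<=` clspan G.
Proof.
move=> x Gx e e0; exists x; last by rewrite subrr nrm20.
by exists 1%N, (fun=> 1), (fun=> x); split=> //; rewrite big_ord1 scale1r.
Qed.

Lemma clspanS G G' : G `<=` G' -> clspan G `<=` clspan G'.
Proof.
move=> GG; apply: clspan_cs; first exact: clspan_closed.
by apply: subset_trans GG _; exact: sub_clspan.
Qed.

(** Cauchy-Schwarz makes the product with [x] continuous for the seminorm. This is what extends
    orthogonality from generators to their closed span. *)
Lemma perp_closed x : closed_subspace [set z | h x z = 0].
Proof.
split => /=.
- by apply: ip_eq0C; rewrite ip0l.
- by move=> a y z xy xz; rewrite ipDr ipZr xy xz mulr0 addr0.
move=> y H; apply: ip_eq0C; apply: rip_ip0 => a.
pose s := complex.Re a ^+ 2 + complex.Im a ^+ 2.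
apply: (@rip_approx0 _ _ (s * nrm2 x)) => e /H[z xz yz].
have -> : rip (a *: y) x = rip (a *: (y - z)) x.
  by rewrite scalerBr ripDl ripNl {3}/rip ipZl (ip_eq0C xz) mulr0 /= subr0.
apply: le_trans (cauchy_schwarz _ _) _; rewrite nrm2Z -/s [leRHS]mulrA.
by rewrite ler_wpM2r// mulrC ler_wpM2r ?addr_ge0 ?sqr_ge0// ltW.
Qed.

Lemma perp_clspan x G : (forall z, G z -> h x z = 0) -> perp x (clspan G).
Proof. by move=> H; apply: clspan_cs => //; exact: perp_closed. Qed.

End Semihilbert.

(** * Completeness of L2 *)

Section RealL2.
Context {d : measure_display} {T : measurableType d} {R : realType}.
Variable P : probability T R.
Implicit Types (X Z : T -> R).

Lemma Lfun2_measurable X : X \in Lfun P 2%:E -> measurable_fun [set: T] X.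
Proof. by rewrite inE => /andP[/[!inE]]. Qed.

Lemma Lfun2P X : measurable_fun [set: T] X ->
  (\int[P]_w ((X w) ^+ 2)%:E < +oo)%E -> X \in Lfun P 2%:E.
Proof.
move=> mX iX; rewrite inE; apply/andP; rewrite !inE; split=> //=.
rewrite /finite_norm unlock /=; apply: poweR_lty.
apply: le_lt_trans iX; rewrite le_eqVlt; apply/orP; left; apply/eqP.
apply: eq_integral => w _; rewrite [LHS](_ : _ = (`|X w| `^ 2%:R)%:E) ?powR_mulrn//.
by rewrite real_normK// num_real.
Qed.

Lemma Lfun2_sqr_lty X : X \in Lfun P 2%:E ->
  (\int[P]_w ((X w) ^+ 2)%:E < +oo)%E.
Proof. by move=> /Lfun2_integrable_sqr /(integrable_lty measurableT). Qed.

(** The increments are absolutely summable, and the sequence is its first term plus their partial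
    sums. *)
Lemma cvgn_of_bounded_variation (v : R^nat) (M : R) :
  (forall n, \sum_(0 <= k < n) `|v k.+1 - v k| <= M) -> cvgn v.
Proof.
move=> H; have H1 : cvgn (fun n => \sum_(0 <= k < n) `|v k.+1 - v k|).
  apply: nondecreasing_is_cvgn.
    by apply/nondecreasing_seqP => n; rewrite big_nat_recr//= lerDl.
  by exists M => _ [n _ <-]; exact: H.
have := @normed_cvg R R^o (telescope v) H1; rewrite telescopeK => H2.
have -> : v = (fun n => (v n - v 0%N) + v 0%N).
  by apply/funext => n; rewrite subrK.
by apply: is_cvgD => //; exact: is_cvg_cst.
Qed.

Section RieszFischer.
Variable v : nat -> T -> R.
Hypothesis mv : forall n, measurable_fun [set: T] (v n).
Hypothesis v_fast : forall n,
  (\int[P]_w ((v n.+1 w - v n w) ^+ 2)%:E <= (4^-1 ^+ n)%:E)%E.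

Let dv n w : \bar R := `|v n.+1 w - v n w|%:E.

Let mdv n : measurable_fun [set: T] (dv n).
Proof.
by apply/measurable_EFinP; apply: measurableT_comp => //; exact: measurable_funB.
Qed.

(* AM-GM: [2 |x| <= 2^n x^2 + 2^-n] *)
Let dv_int n : (\int[P]_w dv n w <= (geometric 1 (2^-1) n)%:E)%E.
Proof.
have msq : measurable_fun [set: T] (fun w => ((v n.+1 w - v n w) ^+ 2)%:E).
  by apply/measurable_EFinP; apply: measurable_funX; exact: measurable_funB.
pose c : R := 2 ^+ n / 2; have c0 : 0 <= c by rewrite divr_ge0 ?exprn_ge0.
pose b : R := 2^-1 ^+ n / 2; have b0 : 0 <= b by rewrite divr_ge0 ?exprn_ge0 ?invr_ge0.
apply: (@le_trans _ _
  (\int[P]_w (c%:E * ((v n.+1 w - v n w) ^+ 2)%:E + b%:E))%E).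
  apply: ge0_le_integral => //.
  - by move=> w _; rewrite lee_fin.
  - by apply: emeasurable_funD => //; apply: emeasurable_funM.
  move=> w _; rewrite /dv -EFinM -EFinD lee_fin.
  set x := v n.+1 w - v n w.
  have pq : 2 ^+ n * 2^-1 ^+ n = 1 :> R by rewrite -exprMn mulfV// expr1n.
  have q0 : 0 <= 2^-1 ^+ n :> R by rewrite exprn_ge0 ?invr_ge0.
  have := mulr_ge0 q0 (sqr_ge0 (2 ^+ n * `|x| - 1)).
  rewrite /c /b -(real_normK (num_real x)); move: `|x| (2 ^+ n) (2^-1 ^+ n) pq.
  move=> r p q pq.
  have -> : q * (p * r - 1) ^+ 2 = (p * q) * (p * r ^+ 2) - 2 * (p * q) * r + q.
    ring.
  rewrite pq; lra.
rewrite ge0_integralD//; last 2 first.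
- by move=> w _; rewrite mule_ge0 ?lee_fin ?sqr_ge0.
- exact: emeasurable_funM.
rewrite ge0_integralZl//; last by move=> w _; rewrite lee_fin sqr_ge0.
rewrite integral_cst// [X in (_ + _ * X)%E](_ : _ = 1%E) ?mule1; last exact: probability_setT.
apply: (@le_trans _ _ (c%:E * (4^-1 ^+ n)%:E + b%:E)%E).
  by apply: leeD => //; apply: lee_wpmul2l.
rewrite -EFinM -EFinD lee_fin /geometric /= mul1r /c /b.
have -> : 2 ^+ n / 2 * 4^-1 ^+ n = (2^-1 ^+ n) / 2 :> R.
  rewrite mulrAC -exprMn; congr (_ ^+ n / 2); lra.
lra.
Qed.

Let g w : \bar R := (\sum_(n <oo) dv n w)%E.

(** By monotone convergence the integral of the total variation [g] is at most the geometric series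
    of the bounds in [dv_int], and an integrable function is finite almost everywhere. *)
Let g_fin : {ae P, forall w, g w \is a fin_num}.
Proof.
have dv0 n w : (0 <= dv n w)%E by rewrite lee_fin.
have mg : measurable_fun [set: T] g.
  by apply: ge0_emeasurable_sum => // n w _ _; exact: dv0.
have ig : P.-integrable [set: T] g.
  apply/integrableP; split=> //.
  have -> : (\int[P]_w `|g w| = \int[P]_w g w)%E.
    by apply: eq_integral => w _; rewrite gee0_abs// nneseries_ge0.
  rewrite /g integral_nneseries//.
  apply: (@le_lt_trans _ _ (\sum_(n <oo) (geometric 1 (2^-1 : R) n)%:E)%E).
    by apply: lee_nneseries => // n _ _; exact: integral_ge0.
  have -> : (\sum_(n <oo) (geometric 1 (2^-1 : R) n)%:E = (1 / (1 - 2^-1))%:E)%E.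
    apply/cvg_lim => //.
    under eq_fun do rewrite sumEFin.
    apply: cvg_EFin; first exact: nearW.
    by apply: cvg_geometric_series; rewrite ger0_norm ?invr_ge0// invf_lt1 ?ltr1n.
  by rewrite ltry.
have := integrable_ae measurableT ig.
by apply: filterS => w; apply.
Qed.

Lemma fast_cauchy_ae_cvg : {ae P, forall w, cvgn (v ^~ w)}.
Proof.
move: g_fin; apply: filterS => w gw.
apply: (@cvgn_of_bounded_variation _ (fine (g w))) => n.
rewrite -lee_fin fineK// -sumEFin.
by apply: nneseries_lim_ge => k _; rewrite lee_fin.
Qed.

End RieszFischer.

(** Fatou's lemma, applied to the sequence shifted by [N] so that every term satisfies the bound. *)
Lemma fatou_limit_sqr (v : nat -> T -> R) (f u : T -> R) (e : R) (N : nat) :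
  (forall n, measurable_fun [set: T] (v n)) -> measurable_fun [set: T] u ->
  (forall w, v ^~ w @ \oo --> f w) ->
  (forall n, (N <= n)%N -> (\int[P]_w ((v n w - u w) ^+ 2)%:E <= e%:E)%E) ->
  (\int[P]_w ((f w - u w) ^+ 2)%:E <= e%:E)%E.
Proof.
move=> mv mu vf H.
have msq n : measurable_fun [set: T] (fun w => ((v n w - u w) ^+ 2)%:E).
  by apply/measurable_EFinP; apply: measurable_funX; exact: measurable_funB.
have := @fatou _ _ _ P setT measurableT (fun n w => ((v (n + N)%N w - u w) ^+ 2)%:E)
  (fun n => msq (n + N)%N) (fun n w _ => sqr_ge0 _).
have -> : (\int[P]_w limn_einf (fun n => ((v (n + N)%N w - u w) ^+ 2)%:E) =
           \int[P]_w ((f w - u w) ^+ 2)%:E)%E.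
  apply: eq_integral => w _.
  have cv : (fun n => ((v (n + N)%N w - u w) ^+ 2)%:E) @ \oo --> ((f w - u w) ^+ 2)%:E.
    apply: cvg_EFin; first exact: nearW.
    have : (fun n => v (n + N)%N w) @ \oo --> f w by rewrite (cvg_shiftn N (v ^~ w)).
    by move=> c; apply: (cvgM (cvgB c (cvg_cst _)) (cvgB c (cvg_cst _))).
  by have [-> _] := cvg_limn_einf_sup cv.
move=> /le_trans; apply.
rewrite limn_einf_lim; apply: lime_le; first exact: is_cvg_einfs.
apply: nearW => n; apply: le_trans (H (n + N)%N _); last exact: leq_addl.
by apply: ereal_inf_lbound; exists n => /=.
Qed.

(** Riesz-Fischer: a subsequence whose squared increments have integral at most [4^-n] converges
    almost everywhere, and Fatou's lemma carries the Cauchy estimate over to its limit. *)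
Lemma L2_complete (u : nat -> T -> R) : (forall n, u n \in Lfun P 2%:E) ->
  (forall e : R, 0 < e -> exists N, forall m n, (N <= m)%N -> (N <= n)%N ->
     (\int[P]_w ((u m w - u n w) ^+ 2)%:E < e%:E)%E) ->
  exists2 f, f \in Lfun P 2%:E & forall e : R, 0 < e -> exists N, forall n, (N <= n)%N ->
     (\int[P]_w ((f w - u n w) ^+ 2)%:E < e%:E)%E.
Proof.
move=> uL uC; have mu n := Lfun2_measurable (uL n).
have q0 n : 0 < 4^-1 ^+ n :> R by rewrite exprn_gt0.
pose N0 n := projT1 (cid (uC _ (q0 n))).
have N0P n : forall i j, (N0 n <= i)%N -> (N0 n <= j)%N ->
    (\int[P]_w ((u i w - u j w) ^+ 2)%:E < (4^-1 ^+ n)%:E)%E.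
  by rewrite /N0; case: cid.
(* The maximum puts [phi n] beyond the thresholds of all accuracies up to [n], so consecutive terms,
   and any two later ones, are comparable at level [n]. *)
pose phi n := (\max_(i < n.+1) N0 i)%N.
have phi_ge i n : (i <= n)%N -> (N0 i <= phi n)%N.
  move=> le_in; have lt_in : (i < n.+1)%N by [].
  exact: (leq_bigmax (Ordinal lt_in)).
pose v n := u (phi n).
have mv n : measurable_fun [set: T] (v n) by exact: mu.
have v_fast n : (\int[P]_w ((v n.+1 w - v n w) ^+ 2)%:E <= (4^-1 ^+ n)%:E)%E.
  by apply: ltW; apply: N0P; apply: phi_ge.
have [B [mB PB0 HB]] := fast_cauchy_ae_cvg mv v_fast.
(* Setting the sequence to zero on the null set [B] makes it converge everywhere, which gives a
   measurable limit. *)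
pose v' n w := v n w * \1_(~` B) w.
have mv' n : measurable_fun [set: T] (v' n).
  by apply: measurable_funM => //; apply: measurable_indic; exact: measurableC.
have cv' w : cvgn (v' ^~ w).
  rewrite /v' indicE; case: (boolP (w \in ~` B)) => wB /=.
    under eq_fun do rewrite mulr1.
    apply: contrapT => ncv; move: wB; rewrite inE; apply.
    exact: HB.
  under eq_fun do rewrite mulr0.
  exact: is_cvg_cst.
pose f w := limn (v' ^~ w).
have mf : measurable_fun [set: T] f.
  by apply: (measurable_fun_cvg mv') => w _; exact: cv'.
have fu n m : (phi n <= m)%N ->
    (\int[P]_w ((f w - u m w) ^+ 2)%:E <= (4^-1 ^+ n)%:E)%E.
  move=> nm; apply: (@fatou_limit_sqr v' _ _ _ n) => // i ni.
  rewrite (_ : integral _ _ _ = \int[P]_w ((v i w - u m w) ^+ 2)%:E)%E; last first.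
    have msq (X : T -> R) : measurable_fun [set: T] X ->
        measurable_fun [set: T] (fun w => ((X w - u m w) ^+ 2)%:E).
      by move=> mX; apply/measurable_EFinP; apply: measurable_funX; exact: measurable_funB.
    apply: ae_eq_integral => //; [exact: msq|exact: msq|].
    exists B; split=> // w; apply: contra_notP => wB _.
    by rewrite /v' indicE mem_set//= mulr1.
  apply: ltW; apply: N0P; first exact: phi_ge.
  by apply: leq_trans nm; exact: phi_ge.
exists f.
  apply: Lfun2P => //.
  pose D := fun w => f w - u (phi 0%N) w.
  have mD : measurable_fun [set: T] D by exact: measurable_funB.
  have msq (X : T -> R) : measurable_fun [set: T] X ->
      measurable_fun [set: T] (fun w => ((X w) ^+ 2)%:E).
    by move=> mX; apply/measurable_EFinP; exact: measurable_funX.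
  apply: (@le_lt_trans _ _
    (\int[P]_w (2%:E * ((D w) ^+ 2)%:E + 2%:E * ((u (phi 0%N) w) ^+ 2)%:E))%E).
    apply: ge0_le_integral => //.
    - by move=> w _; rewrite lee_fin sqr_ge0.
    - exact: msq.
    - by apply: emeasurable_funD; apply: emeasurable_funM => //; exact: msq.
    move=> w _; rewrite -!EFinM -EFinD lee_fin /D.
    (* With [u] for [u (phi 0)], this square is exactly [2 (f - u)^2 + 2 u^2 - f^2]. *)
    have := sqr_ge0 (f w - 2 * u (phi 0%N) w); rewrite !expr2; lra.
  have c0 (X : T -> R) w : (0 <= 2%:E * ((X w) ^+ 2)%:E)%E.
    by rewrite -EFinM lee_fin mulr_ge0 ?sqr_ge0.
  rewrite ge0_integralD//; last 2 first.
  - by apply: emeasurable_funM => //; exact: msq.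
  - by apply: emeasurable_funM => //; exact: msq.
  have s0 (X : T -> R) w : (0 <= ((X w) ^+ 2)%:E)%E by rewrite lee_fin sqr_ge0.
  have iZ X : measurable_fun [set: T] X ->
      (\int[P]_w (2%:E * ((X w) ^+ 2)%:E) = 2%:E * \int[P]_w ((X w) ^+ 2)%:E)%E.
    by move=> mX; rewrite ge0_integralZl//; exact: msq.
  rewrite !iZ//.
  rewrite lte_add_pinfty// lte_mul_pinfty ?integral_ge0//.
  + by rewrite (le_lt_trans (fu 0%N _ (leqnn _)))// ltry.
  + by rewrite Lfun2_sqr_lty.
move=> e e0.
have [n ne] : exists n, 4^-1 ^+ n < e.
  have h : `|4^-1 : R| < 1 by rewrite ger0_norm ?invr_ge0// invf_lt1 ?ltr1n.
  have /cvgrPdist_lt/(_ _ e0)[n _ /(_ n (leqnn n))] := @cvg_geometric R 1 _ h.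
  rewrite sub0r normrN /= mul1r ger0_norm; first by exists n.
  exact: ltW.
by exists (phi n) => m nm; apply: le_lt_trans (fu _ _ nm) _; rewrite lte_fin.
Qed.

End RealL2.

(** * Linearity of the complex integral *)

Section ComplexIntegralTheory.
Context {d : measure_display} {T : measurableType d} {R : realType}.
Variable mu : {measure set T -> \bar R}.
Implicit Types (g : T -> R[i]) (c : R[i]).

Lemma cintegrableD g1 g2 : cintegrable mu g1 -> cintegrable mu g2 ->
  cintegrable mu (fun w => g1 w + g2 w).
Proof.
move=> [r1 i1] [r2 i2]; split.
  have := integrableD measurableT r1 r2.
  by apply: eq_integrable => // w _; rewrite /= ReD.
have := integrableD measurableT i1 i2.
by apply: eq_integrable => // w _; rewrite /= ImD.
Qed.

Lemma cintegralD g1 g2 : cintegrable mu g1 -> cintegrable mu g2 ->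
  cintegral mu (fun w => g1 w + g2 w) = cintegral mu g1 + cintegral mu g2.
Proof.
move=> [r1 i1] [r2 i2]; apply: complexP; rewrite ReImE /= -RintegralD//.
  by apply: eq_Rintegral => w _; rewrite ReD.
by apply: eq_Rintegral => w _; rewrite ImD.
Qed.

Lemma cintegrableZ c g : cintegrable mu g -> cintegrable mu (fun w => c * g w).
Proof.
move=> [r1 i1]; split.
  have := integrableB measurableT (integrableZl measurableT (complex.Re c) r1)
    (integrableZl measurableT (complex.Im c) i1).
  by apply: eq_integrable => // w _; rewrite /= ReM.
have := integrableD measurableT (integrableZl measurableT (complex.Re c) i1)
    (integrableZl measurableT (complex.Im c) r1).
by apply: eq_integrable => // w _; rewrite /= ImM.
Qed.

Lemma cintegralZ c g : cintegrable mu g ->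
  cintegral mu (fun w => c * g w) = c * cintegral mu g.
Proof.
move=> [r1 i1]; apply: complexP; rewrite ReImE /= -!RintegralZl// -1?RintegralB// -1?RintegralD//.
- by apply: eq_Rintegral => w _; rewrite ReM.
- exact: (integrableZl measurableT _ r1).
- exact: (integrableZl measurableT _ i1).
- by apply: eq_Rintegral => w _; rewrite ImM.
- exact: (integrableZl measurableT _ i1).
- exact: (integrableZl measurableT _ r1).
Qed.

Lemma cintegrable0 : cintegrable mu (fun=> 0).
Proof. by split; exact: integrable0. Qed.

Lemma cintegral0 : cintegral mu (fun=> 0) = 0.
Proof. by apply: complexP; rewrite /= /Rintegral integral0. Qed.

Lemma cintegrable_sum (I : finType) (g : I -> T -> R[i]) :
  (forall i, cintegrable mu (g i)) -> cintegrable mu (fun w => \sum_i g i w).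
Proof.
move=> ig; suff H s : cintegrable mu (fun w => \sum_(i <- s) g i w) by exact: H.
elim: s => [|i s IH].
  by under eq_fun do rewrite big_nil; exact: cintegrable0.
by under eq_fun do rewrite big_cons; exact: cintegrableD.
Qed.

Lemma cintegral_sum (I : finType) (g : I -> T -> R[i]) :
  (forall i, cintegrable mu (g i)) ->
  cintegral mu (fun w => \sum_i g i w) = \sum_i cintegral mu (g i).
Proof.
move=> ig.
suff H s : cintegrable mu (fun w => \sum_(i <- s) g i w) /\
  cintegral mu (fun w => \sum_(i <- s) g i w) = \sum_(i <- s) cintegral mu (g i).
  by case: (H (index_enum I)).
elim: s => [|i s [IH1 IH2]].
  under eq_fun do rewrite big_nil.
  by rewrite big_nil cintegral0; split=> //; exact: cintegrable0.
under eq_fun do rewrite big_cons.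
by rewrite big_cons -IH2 cintegralD//; split=> //; exact: cintegrableD.
Qed.

End ComplexIntegralTheory.

(** * Square-integrable complex random variables as a complete semi-inner product space *)

Section ComplexL2Space.
Context {d : measure_display} {T : measurableType d} {R : realType}.
Variable P : probability T R.
Implicit Types (X Z : T -> R[i]).

Definition cL2p : {pred T -> R[i]} := mem (cL2 P).

Lemma cL2p_submod : submod_closed cL2p.
Proof.
have [L0 LD] := Lfun_submod_closed P (lee1n 2 : (1 <= 2%:E :> \bar R)%E).
split=> [|c X Z]; rewrite !inE; first by split; exact: L0.
move=> [rX iX] [rZ iZ]; split.
  rewrite (_ : (fun w => _) = complex.Re c *: (fun w => complex.Re (X w)) +
      (- complex.Im c *: (fun w => complex.Im (X w)) + (fun w => complex.Re (Z w)))).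
    by apply: (LD) => //; exact: (LD).
  by apply/funext => w /=; rewrite ReD ReM -addrA -mulNr.
rewrite (_ : (fun w => _) = complex.Re c *: (fun w => complex.Im (X w)) +
    (complex.Im c *: (fun w => complex.Re (X w)) + (fun w => complex.Im (Z w)))).
  by apply: (LD) => //; exact: (LD).
by apply/funext => w /=; rewrite ImD ImM -addrA.
Qed.
HB.instance Definition _ :=
  GRing.isSubmodClosed.Build R[i] (T -> R[i]) cL2p cL2p_submod.

(** Vectors are representatives rather than classes, so that they match the functions on which
    [proj] and [closed_span] operate. *)
Record cl2 := CL2 { cval : T -> R[i]; cvalP : cval \in cL2p }.
HB.instance Definition _ := [isSub for cval].
HB.instance Definition _ := [Choice of cl2 by <:].
HB.instance Definition _ := [SubChoice_isSubLmodule of cl2 by <:].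
Implicit Types x y z : cl2.

Lemma cvalL2 x : cL2 P (cval x).
Proof. by have := cvalP x; rewrite inE. Qed.

Definition mkcl2 X (LX : cL2 P X) : cl2 := CL2 (mem_set LX).

Lemma cl2_inj x y : cval x = cval y -> x = y.
Proof. exact: val_inj. Qed.

Lemma cval_sum n (c : 'I_n -> R[i]) (u : 'I_n -> cl2) w :
  cval (\sum_(i < n) c i *: u i) w = \sum_(i < n) c i * cval (u i) w.
Proof.
elim: n c u => [|n IH] c u; first by rewrite !big_ord0.
by rewrite !big_ord_recr /= -IH.
Qed.

Lemma cinner_integrable X Z : cL2 P X -> cL2 P Z ->
  cintegrable P (fun w => X w * (Z w)^*).
Proof.
move=> [rX iX] [rZ iZ].
have m A B : A \in Lfun P 2%:E -> B \in Lfun P 2%:E ->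
    P.-integrable [set: T] (fun w => (A w * B w)%:E).
  by move=> LA LB; apply/Lfun1_integrable; exact: Lfun2_mul_Lfun1.
split.
  have := integrableD measurableT (m _ _ rX rZ) (m _ _ iX iZ).
  by apply: eq_integrable => // w _; rewrite /= ReM ReJ ImJ mulrN opprK.
have := integrableB measurableT (m _ _ iX rZ) (m _ _ rX iZ).
by apply: eq_integrable => // w _; rewrite /= ImM ReJ ImJ mulrN addrC.
Qed.

Lemma cinner_self X : cL2 P X ->
  (complex.Re (cinner P X X))%:E =
  (\int[P]_w (complex.Re (X w) ^+ 2 + complex.Im (X w) ^+ 2)%:E)%E.
Proof.
move=> LX; have [/integrable_fin_num H _] := cinner_integrable LX LX.
rewrite /= /Rintegral fineK ?H//; apply: eq_integral => w _.
by rewrite ReM ReJ ImJ mulrN opprK -!expr2.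
Qed.

Lemma cl2_linear a x y z : cinner P (cval (a *: x + y)) (cval z) =
  a * cinner P (cval x) (cval z) + cinner P (cval y) (cval z).
Proof.
have [xz yz] := (cinner_integrable (cvalL2 x) (cvalL2 z),
                 cinner_integrable (cvalL2 y) (cvalL2 z)).
rewrite /cinner -cintegralZ// -cintegralD//; last exact: cintegrableZ.
by congr (cintegral P _); apply/funext => w; rewrite mulrA -mulrDl.
Qed.

Lemma cl2_ge0 x : 0 <= complex.Re (cinner P (cval x) (cval x)).
Proof.
rewrite -lee_fin cinner_self; last exact: cvalL2.
by apply: integral_ge0 => w _; rewrite lee_fin addr_ge0 ?sqr_ge0.
Qed.

Lemma cL2_msq X : cL2 P X ->
  measurable_fun [set: T] (fun w => (complex.Re (X w) ^+ 2)%:E) /\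
  measurable_fun [set: T] (fun w => (complex.Im (X w) ^+ 2)%:E).
Proof.
move=> [rX iX]; split; apply/measurable_EFinP; apply: measurable_funX.
  exact: Lfun2_measurable rX.
exact: Lfun2_measurable iX.
Qed.

Lemma cinner_selfD X : cL2 P X -> (complex.Re (cinner P X X))%:E =
  (\int[P]_w (complex.Re (X w) ^+ 2)%:E + \int[P]_w (complex.Im (X w) ^+ 2)%:E)%E.
Proof.
move=> LX; have [mr mi] := cL2_msq LX.
rewrite cinner_self//; under eq_integral do rewrite EFinD.
by rewrite ge0_integralD// => w _; rewrite lee_fin sqr_ge0.
Qed.

(** The squared seminorm is the sum of those of the real and imaginary parts, so real completeness
    applies to each part. *)
Lemma cl2_complete (u : nat -> cl2) :
  (forall e : R, 0 < e -> exists N, forall m n, (N <= m)%N -> (N <= n)%N ->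
     complex.Re (cinner P (cval (u m - u n)) (cval (u m - u n))) < e) ->
  exists x, forall e : R, 0 < e -> exists N, forall n, (N <= n)%N ->
     complex.Re (cinner P (cval (x - u n)) (cval (x - u n))) < e.
Proof.
move=> uC.
have eqle (a b : \bar R) : a = b -> (a <= b)%E by move=> ->.
have sq0 (X : T -> R) : (0 <= \int[P]_w ((X w) ^+ 2)%:E)%E.
  by apply: integral_ge0 => w _; rewrite lee_fin sqr_ge0.
have [|e e0|r Lr rP] := @L2_complete _ _ _ P (fun n w => complex.Re (cval (u n) w)).
- by move=> n; case: (cvalL2 (u n)).
- have [N HN] := uC e e0; exists N => m n Nm Nn.
  have := HN m n Nm Nn; rewrite -lte_fin cinner_selfD; last exact: cvalL2.
  apply: le_lt_trans; apply: le_trans (leeDl _ (sq0 _)).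
  by apply: eqle; apply: eq_integral => w _; rewrite ReD ReN.
have [|e e0|i Li iP] := @L2_complete _ _ _ P (fun n w => complex.Im (cval (u n) w)).
- by move=> n; case: (cvalL2 (u n)).
- have [N HN] := uC e e0; exists N => m n Nm Nn.
  have := HN m n Nm Nn; rewrite -lte_fin cinner_selfD; last exact: cvalL2.
  apply: le_lt_trans; apply: le_trans (leeDr _ (sq0 _)).
  by apply: eqle; apply: eq_integral => w _; rewrite ImD ImN.
have LX : cL2 P (fun w => r w +i* i w) by [].
exists (mkcl2 LX) => e e0; have e2 : 0 < e / 2 by rewrite divr_gt0.
have [N1 H1] := rP _ e2; have [N2 H2] := iP _ e2.
exists (maxn N1 N2) => n; rewrite geq_max => /andP[n1 n2].
rewrite -lte_fin cinner_selfD; last exact: cvalL2.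
rewrite [e]splitr EFinD; apply: lteD.
  by apply: le_lt_trans (H1 n n1); apply: eqle; apply: eq_integral => w _; rewrite ReD ReN.
by apply: le_lt_trans (H2 n n2); apply: eqle; apply: eq_integral => w _; rewrite ImD ImN.
Qed.

Definition cl2_semihilbert : semihilbert cl2 :=
  Semihilbert cl2_linear (fun x y => cinnerC P (cval x) (cval y)) cl2_ge0 cl2_complete.

Lemma expectation_nrm2 x y :
  'E_P[fun w => (Normc.normc (cval x w - cval y w) ^+ 2)%R]%E =
  (nrm2 cl2_semihilbert (x - y))%:E.
Proof.
rewrite unlock cinner_self; last exact: cvalL2.
apply: eq_integral => w _; congr (_%:E).
have normc2 (z : R[i]) : Normc.normc z ^+ 2 = complex.Re z ^+ 2 + complex.Im z ^+ 2.
  by case: z => r i /=; rewrite sqr_sqrtr// addr_ge0 ?sqr_ge0.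
exact: normc2.
Qed.

Lemma closed_span_cval (S : set (T -> R[i])) x : S `<=` cL2 P ->
  closed_span P S (cval x) <-> clspan cl2_semihilbert (cval @^-1` S) x.
Proof.
move=> SL; split=> [[_ H] e e0|H].
  have [Z [n [c [z [Sz ->]]]] lt] := H e e0.
  pose u i := mkcl2 (SL _ (Sz i)).
  exists (\sum_(i < n) c i *: u i); first by exists n, c, u.
  have ZE : (fun w => \sum_(i < n) c i * z i w) = cval (\sum_(i < n) c i *: u i).
    by apply/funext => w; rewrite cval_sum.
  by rewrite -lte_fin -expectation_nrm2 -ZE.
split; first exact: cvalL2.
move=> e /H[z [n [c [u [Su ->]]]] lt].
exists (cval (\sum_(i < n) c i *: u i)); last by rewrite expectation_nrm2 lte_fin.
exists n, c, (cval \o u); split=> //.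
by apply/funext => w; rewrite cval_sum.
Qed.

Lemma closed_span_cL2 (S : set (T -> R[i])) : closed_span P S `<=` cL2 P.
Proof. by move=> X []. Qed.

(** [proj] is a choice with default value zero. The projection theorem shows that there is something
    to choose, so the chosen function has the defining property. *)
Lemma proj_is_proj (S : set (T -> R[i])) x : S `<=` cL2 P ->
  exists2 p, cval p = Defs.proj P (closed_span P S) (cval x) &
    is_proj cl2_semihilbert (clspan cl2_semihilbert (cval @^-1` S)) x p.
Proof.
move=> SL; have [q [q1 q2]] := projection (clspan_closed cl2_semihilbert (cval @^-1` S)) x.
have [] : [set X' | closed_span P S X' /\ forall Z, closed_span P S Z ->
    cinner P (fun w => cval x w - X' w) Z = 0] (Defs.proj P (closed_span P S) (cval x)).
  apply: (@xgetPex _ (fun=> 0)); exists (cval q); split; first exact/closed_span_cval.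
  move=> Z SZ; have LZ := closed_span_cL2 SZ.
  by have := q2 (mkcl2 LZ); apply; apply/closed_span_cval.
move=> S1 S2; have L1 := closed_span_cL2 S1.
exists (mkcl2 L1) => //; split; first exact/closed_span_cval.
by move=> z Sz; apply: S2; exact/closed_span_cval.
Qed.

End ComplexL2Space.

(** * Innovations and partial orthogonality *)

Section LinearSpan.
Context {R : realType} {V : lmodType R[i]} (h : semihilbert V).
Implicit Types (G W : set V) (x z : V).

Lemma lspan_ind G W : W 0 -> (forall a x z, W x -> W z -> W (a *: x + z)) ->
  G `<=` W -> lspan G `<=` W.
Proof.
move=> W0 WD GW x [n [c [u [Gu ->]]]].
by elim/big_rec: _ => // i z _ Wz; apply: WD => //; exact: GW.
Qed.

Lemma sub_lspan G : G `<=` lspan G.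
Proof.
by move=> x Gx; exists 1%N, (fun=> 1), (fun=> x); rewrite big_ord1 scale1r.
Qed.

Lemma lspanD G x z : lspan G x -> lspan G z -> lspan G (x + z).
Proof. by rewrite -{2}[x]scale1r; exact: lspan_lin. Qed.

Lemma lspanZ G a x : lspan G x -> lspan G (a *: x).
Proof. by move=> Gx; rewrite -[_ *: _]addr0; apply: lspan_lin => //; exact: lspan0. Qed.

Lemma lspanS G W : G `<=` W -> lspan G `<=` lspan W.
Proof.
move=> GW; apply: lspan_ind; [exact: lspan0|by move=> *; exact: lspan_lin|].
by move=> x /GW; exact: sub_lspan.
Qed.

Lemma lspan_perp x G : (forall z, G z -> h x z = 0) -> forall z, lspan G z -> h x z = 0.
Proof.
move=> H z Gz; have [c0 cD _] := perp_closed h x.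
exact: (lspan_ind (W := [set z | h x z = 0]) c0 cD H Gz).
Qed.

Lemma lspan_split G1 G2 z : lspan (G1 `|` G2) z ->
  exists z1 z2, [/\ lspan G1 z1, lspan G2 z2 & z = z1 + z2].
Proof.
move: z; apply: lspan_ind.
- by exists 0, 0; split; rewrite ?addr0//; exact: lspan0.
- move=> a _ _ [x1 [x2 [X1 X2 ->]]] [z1 [z2 [Z1 Z2 ->]]].
  exists (a *: x1 + z1), (a *: x2 + z2); split; [exact: lspan_lin..|].
  by rewrite scalerDr addrACA.
move=> z [Gz|Gz].
  by exists z, 0; rewrite addr0; split=> //; [exact: sub_lspan|exact: lspan0].
by exists 0, z; rewrite add0r; split=> //; [exact: lspan0|exact: sub_lspan].
Qed.

End LinearSpan.

(** * Closed spans of a process over sets of coordinates and times *)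

Section Processes.
Context {R : realType} {V : lmodType R[i]} (h : semihilbert V).
Context {I : Type} (y : I -> R -> V).
Implicit Types (C A : set I) (S : set R) (s t : R) (x z : V).

Definition tgen C S : set V := [set y c s | c in C & s in S].
Definition tspan C S : set V := clspan h (tgen C S).

Lemma tgenS C C' S S' : C `<=` C' -> S `<=` S' -> tgen C S `<=` tgen C' S'.
Proof. by move=> CC SS _ [c Cc [s Ss <-]]; exists c; [exact: CC|exists s; [exact: SS|]]. Qed.

Lemma tspan_closed C S : closed_subspace h (tspan C S).
Proof. exact: clspan_closed. Qed.

Lemma tspanS C C' S S' : C `<=` C' -> S `<=` S' -> tspan C S `<=` tspan C' S'.
Proof. by move=> CC SS; apply: clspanS; exact: tgenS. Qed.

Lemma tspan_gen C S c s : C c -> S s -> tspan C S (y c s).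
Proof. by move=> Cc Ss; apply: sub_clspan; exists c => //; exists s. Qed.

Let F t := tspan setT [set s | s <= t].

Let F_le s t : s <= t -> F s `<=` F t.
Proof. by move=> st; apply: tspanS => // r /= rs; exact: le_trans st. Qed.

(** * Innovations [e v t s]: the errors in predicting [y v (t + s)] from the full past [F t] *)

Section Innovations.
Variables (A : set I) (e : I -> R -> R -> V).
Hypothesis e_proj : forall v t s, 0 <= s <= 1 ->
  is_proj h (F t) (y v (t + s)) (y v (t + s) - e v t s).
Hypothesis e_orth : forall v v' t s s', A v -> ~ A v' ->
  0 <= s <= 1 -> 0 <= s' <= 1 -> h (e v t s) (e v' t s') = 0.
Hypothesis remote_past : forall x, (forall t, F t x) -> nrm2 h x = 0.

Let egen C t : set V := [set e v t s | v in C & s in [set s | 0 <= s <= 1]].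

Let e_perp v t s : 0 <= s <= 1 -> perp h (e v t s) (F t).
Proof. by move=> /(e_proj v t)[_]; rewrite subKr. Qed.

Let e_F v t s : 0 <= s <= 1 -> F (t + 1) (e v t s).
Proof.
move=> s01; have cF := tspan_closed setT [set r | r <= t + 1].
rewrite -[e v t s](subKr (y v (t + s))); apply: (csB cF).
  apply: tspan_gen => //=; rewrite lerD2l; by case/andP: s01.
by apply: F_le (proj1 (e_proj v t s01)); rewrite lerDl.
Qed.

(** A generator at a time up to [t] is already in [F t]; one at a time in [(t, t + 1]] is its
    innovation plus its prediction. The step length 1 is the largest horizon for which innovations
    are controlled. *)
Let decomposition t w : lspan (tgen setT [set s | s <= t + 1]) w ->
  exists XA XB f, [/\ lspan (egen A t) XA, lspan (egen (~` A) t) XB, F t f &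
    w = XA + XB + f].
Proof.
have cF := tspan_closed setT [set r | r <= t].
move: w; apply: lspan_ind.
- exists 0, 0, 0; split; [exact: lspan0|exact: lspan0|exact: (cs0 cF)|].
  by rewrite !addr0.
- move=> a _ _ [xa [xb [xf [Xa Xb Xf ->]]]] [za [zb [zf [Za Zb Zf ->]]]].
  exists (a *: xa + za), (a *: xb + zb), (a *: xf + zf); split.
  + exact: lspan_lin.
  + exact: lspan_lin.
  + by apply: (csD cF) => //; exact: (csZ cF).
  + by rewrite !scalerDr [LHS]addrACA; congr (_ + _); rewrite addrACA.
move=> _ [v _ [s /= st <-]]; have [ts|ts] := leP s t.
  exists 0, 0, (y v s); split; [exact: lspan0|exact: lspan0| |by rewrite !add0r].
  exact: tspan_gen.
have s01 : 0 <= s - t <= 1 by lra.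
have ys : y v s = e v t (s - t) + (y v s - e v t (s - t)) by rewrite addrC subrK.
have Fy : F t (y v s - e v t (s - t)).
  by have [+ _] := e_proj v t s01; rewrite [t + _]addrC subrK.
have ge : forall C, C v -> lspan (egen C t) (e v t (s - t)).
  by move=> C Cv; apply: sub_lspan; exists v => //; exists (s - t).
have [Av|Av] := pselect (A v).
  exists (e v t (s - t)), 0, (y v s - e v t (s - t)).
  by rewrite addr0; split=> //; [exact: ge|exact: lspan0].
exists 0, (e v t (s - t)), (y v s - e v t (s - t)).
by rewrite add0r; split=> //; [exact: lspan0|exact: ge].
Qed.

(** Approximate [D] by [w = XA + XB + f]. Both [D] and [XA] are orthogonal to [XB + f], so by
    Pythagoras [XA] alone is at least as close to [D] as [w], and [z] is orthogonal to [XA]. *)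
Let innovation_perp D z t : F (t + 1) D -> perp h D (F t) ->
  (forall v s, ~ A v -> 0 <= s <= 1 -> h D (e v t s) = 0) ->
  (forall v s, A v -> 0 <= s <= 1 -> h z (e v t s) = 0) -> rip h D z = 0.
Proof.
move=> FD Dp DB zA; apply: (@rip_approx0 _ _ _ _ _ (nrm2 h z)) => eps /FD[w Gw wD].
have [XA [XB [f [GA GB Ff wE]]]] := decomposition Gw.
have hDB : h D XB = 0.
  by apply: (lspan_perp _ GB) => _ [v Av [s s01 <-]]; exact: DB.
have hzA : h z XA = 0.
  by apply: (lspan_perp _ GA) => _ [v Av [s s01 <-]]; exact: zA.
have hAB : h XA XB = 0.
  apply: (lspan_perp _ GB) => _ [v Av [s s01 <-]]; apply: ip_eq0C.
  by apply: (lspan_perp _ GA) => _ [v' Av' [s' s01' <-]]; apply: ip_eq0C; exact: e_orth.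
have hAf : h XA f = 0.
  apply: ip_eq0C; apply: (lspan_perp _ GA) => _ [v Av [s s01 <-]].
  by apply: ip_eq0C; exact: e_perp.
have : nrm2 h (D - w) = nrm2 h (D - XA) + nrm2 h (- (XB + f)).
  rewrite -nrm2_pyth; first by rewrite wE -addrA opprD addrA.
  by rewrite ipNr ipBl !ipDr hDB hAB hAf (Dp f Ff) !addr0 subrr oppr0.
move=> pyth; have le_eps : nrm2 h (D - XA) <= eps.
  by have := nrm2_ge0 h (- (XB + f)); lra.
have -> : rip h D z = rip h (D - XA) z.
  by rewrite ripDl ripNl {3}/rip (ip_eq0C hzA) /= subr0.
apply: le_trans (cauchy_schwarz _ _ _) _.
by rewrite ler_wpM2r ?nrm2_ge0.
Qed.

(** With [pr t] the projection of [x] on [F t], the product of [pr t] with [z] does not change under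
    unit steps in [t]. It tends to that of [x] in the future and to zero in the remote past. *)
Let rip_perp x z : tspan setT setT x ->
  (forall v t s, ~ A v -> 0 <= s <= 1 -> h x (e v t s) = 0) ->
  (forall v t s, A v -> 0 <= s <= 1 -> h z (e v t s) = 0) -> rip h x z = 0.
Proof.
move=> xV xB zA; have cF t := tspan_closed setT [set r | r <= t].
pose pr t := projT1 (cid (projection (cF t) x)).
have prP t : is_proj h (F t) x (pr t) by rewrite /pr; case: cid.
have pr_perp s t z' : F s z' -> s <= t -> h (pr t - pr s) z' = 0.
  move=> Fz st; have -> : pr t - pr s = (x - pr s) - (x - pr t).
    by rewrite opprB [RHS]addrC addrA addrNK.
  by rewrite ipBl (proj2 (prP s))// (proj2 (prP t)) ?subrr//; exact: F_le Fz.
(* The increment is [x - pr t] minus [x - pr (t + 1)]. Against an innovation outside [A], the terms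
   in [x] vanish by [xB], the term in [pr t] because it lies in [F t], and [x - pr (t + 1)] because
   the innovation lies in [F (t + 1)]. *)
have step t : rip h (pr (t + 1)) z = rip h (pr t) z.
  apply/eqP; rewrite -subr_eq0 -ripNl -ripDl; apply/eqP.
  have t1 : t <= t + 1 by rewrite lerDl.
  apply: (@innovation_perp _ _ t) => [||v s Av s01|v s Av s01].
  - by apply: (csB (cF (t + 1))); [|apply: (F_le t1)]; exact: (proj1 (prP _)).
  - by move=> w Fw; exact: pr_perp.
  - have -> : pr (t + 1) - pr t = x - pr t - (x - pr (t + 1)).
      by rewrite opprB [RHS]addrC addrA addrNK.
    rewrite 2!ipBl xB// (proj2 (prP (t + 1)) _ (e_F v t s01)) subr0 sub0r.
    by rewrite (ip_eq0C (e_perp v s01 (proj1 (prP t)))) oppr0.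
  - exact: zA.
have stepn n : rip h (pr n%:R) z = rip h (pr (- n%:R)) z.
  have up : rip h (pr n%:R) z = rip h (pr 0) z.
    by elim: n => [//|n IH]; rewrite -[n.+1]addn1 natrD step.
  rewrite up; elim: n {up} => [|n IH]; first by rewrite oppr0.
  by rewrite IH -{1}(subrK 1 (- n%:R)) step -[n.+1]addn1 natrD opprD.
have future eps : 0 < eps -> exists N, forall n, (N <= n)%N -> nrm2 h (x - pr n%:R) < eps.
  move=> eps0; have [w Gw xw] := xV _ eps0.
  have [N FN] : exists N : nat, F N%:R w.
    move: w Gw {xw}; apply: lspan_ind; first by exists 0%N; exact: (cs0 (cF _)).
      move=> a w w' [N Fw] [N' Fw']; exists (maxn N N').
      by apply: (csD (cF _)); [apply: (csZ (cF _)); move: Fw|move: Fw'];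
        apply: F_le; rewrite ler_nat ?leq_maxl ?leq_maxr.
    move=> _ [v _ [s _ <-]]; exists (Num.truncn s).+1; apply: tspan_gen => //=.
    exact/ltW/truncnS_gt.
  exists N => n Nn; apply: le_lt_trans xw.
  have Fw : F n%:R w by apply: F_le FN; rewrite ler_nat.
  have -> : x - w = (x - pr n%:R) + (pr n%:R - w) by rewrite addrA addrNK.
  have Fd : F n%:R (pr n%:R - w) by apply: (csB (cF _)) => //; exact: (proj1 (prP _)).
  by rewrite (nrm2_pyth (proj2 (prP _) _ Fd)) lerDl nrm2_ge0.
pose q n := pr (- n%:R : R).
have le_opp m n : (m <= n)%N -> - n%:R <= - m%:R :> R by rewrite lerN2 ler_nat.
have q_pyth m n : (m <= n)%N -> nrm2 h (q m) = nrm2 h (q m - q n) + nrm2 h (q n).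
  move=> mn; have o : h (q m - q n) (q n) = 0.
    by apply: pr_perp; [exact: (proj1 (prP _))|exact: le_opp].
  by rewrite -(nrm2_pyth o) subrK.
(* By Pythagoras the seminorms of the [q n] decrease and [q] is Cauchy. Its limit lies in every
   [F t], hence is null by [remote_past]. *)
have past eps : 0 < eps -> exists n, nrm2 h (q n) < eps.
  pose S := [set nrm2 h (q n) | n in setT].
  have hS : has_inf S.
    by split; [exists (nrm2 h (q 0%N)), 0%N|exists 0 => _ [n _ <-]; exact: nrm2_ge0].
  have infq n : inf S <= nrm2 h (q n) by apply: ge_inf; [case: hS|exists n].
  have cauchy : forall eps, 0 < eps -> exists N, forall m n, (N <= m)%N -> (N <= n)%N ->
      nrm2 h (q m - q n) < eps.
    move=> d d0; have [_ [N _ <-] qN] := inf_adherent d0 hS.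
    have H m n : (N <= m)%N -> (m <= n)%N -> nrm2 h (q m - q n) < d.
      move=> Nm mn; have := q_pyth _ _ Nm; have := q_pyth _ _ mn.
      have := infq n; have := nrm2_ge0 h (q N - q m); lra.
    exists N => m n Nm Nn; case: (leqP m n) => [|/ltnW] mn; first exact: H.
    by rewrite nrm2BC; exact: H.
  have [z0 lim] := ip_complete cauchy.
  have z00 : nrm2 h z0 = 0.
    apply: remote_past => t; have [_ _] := cF t; apply=> d /lim[N HN].
    pose n := maxn N (Num.truncn (- t)).+1.
    exists (q n); last by apply: HN; rewrite leq_maxl.
    apply: F_le (proj1 (prP _)); rewrite lerNl; apply: ltW.
    by apply: lt_le_trans (truncnS_gt _) _; rewrite ler_nat leq_maxr.
  move=> e0; have e2 : 0 < eps / 2 by rewrite divr_gt0.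
  have [N HN] := lim _ e2; exists N.
  have := HN N (leqnn N); rewrite -/(nrm2 h (z0 - q N)).
  by have := nrm2D_le h z0 (- (z0 - q N)); rewrite nrm2N subKr z00; lra.
(* By [stepn], [pr n] may be replaced by [q n] against [z], so the product of [x] with [z] is that
   of the small vectors [x - pr n] and [q n]. The 4 arises as in [projection]. *)
apply: (@rip_approx0 _ _ _ _ _ (4 * nrm2 h z)) => eps eps0.
have [N HN] := future _ eps0; have [m qm] := past _ eps0.
pose n := maxn N m.
have f1 : nrm2 h (x - pr n%:R) <= eps by apply/ltW/HN; rewrite leq_maxl.
have f2 : nrm2 h (q n) <= eps.
  by apply: le_trans (ltW qm); rewrite (q_pyth _ _ (leq_maxr N m)) lerDr nrm2_ge0.
have -> : rip h x z = rip h (x - pr n%:R) z + rip h (q n) z.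
  by rewrite ripDl ripNl stepn subrK.
have z0 := nrm2_ge0 h z.
have c1 := le_trans (cauchy_schwarz h (x - pr n%:R) z) (ler_wpM2r z0 f1).
have c2 := le_trans (cauchy_schwarz h (q n) z) (ler_wpM2r z0 f2).
have := sqr_ge0 (rip h (x - pr n%:R) z - rip h (q n) z).
move: c1 c2; move: (rip h (x - pr n%:R) z) (rip h (q n) z) => r1 r2.
rewrite !expr2; lra.
Qed.

(* The increments of the projections of [x] on the pasts lie in the closed
   span of the innovations of the coordinates in [A], to which [z] is
   orthogonal. *)
Lemma perp_of_innovations x z : tspan setT setT x ->
  (forall v t s, ~ A v -> 0 <= s <= 1 -> h x (e v t s) = 0) ->
  (forall v t s, A v -> 0 <= s <= 1 -> h z (e v t s) = 0) -> h x z = 0.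
Proof.
move=> xV xB zA; apply: rip_ip0 => a; apply: rip_perp => //.
  exact: (csZ (tspan_closed _ _)).
by move=> v t s Av s01; rewrite ipZl xB// mulr0.
Qed.

End Innovations.

(** Let [w1], free of [a], and [w2], free of [b], both approximate [x], and split [w2] as [u + w3]
    with [u] its [a]-part. Then [w2 - w1] is small and equals [u] plus a vector free of [a], so the
    lower bound makes [u] small, and [w3], free of both, approximates [x]. *)
Lemma tspan_cap (a b : I) (eps : R) : 0 < eps ->
  (forall u w, lspan (tgen [set a] setT) u -> lspan (tgen (~` [set a]) setT) w ->
     eps * nrm2 h u <= nrm2 h (u + w)) ->
  tspan (~` [set a]) setT `&` tspan (~` [set b]) setT `<=` tspan (~` [set a; b]) setT.
Proof.
move=> eps0 H x [xa xb] d d0.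
(* The bounds below give [nrm2 h u <= (4 / eps) d'], so the squared distance from [x] to [w3] is at
   most [2 (1 + 4 / eps) d' = d / 2]. *)
pose d' := d / (4 * (1 + 4 / eps)).
have e4 : 0 < 4 / eps by rewrite divr_gt0.
have d'0 : 0 < d' by rewrite divr_gt0// mulr_gt0// ltr_wpDl// ltW.
have [w1 G1 x1] := xa _ d'0; have [w2 G2 x2] := xb _ d'0.
have [u [w3 [Gu G3 w2E]]] : exists u w3, [/\ lspan (tgen [set a] setT) u,
    lspan (tgen (~` [set a; b]) setT) w3 & w2 = u + w3].
  apply: lspan_split; apply: lspanS G2 => _ [c /= cb [s _ <-]].
  have [ca|ca] := pselect (c = a); first by left; exists c => //; exists s.
  by right; exists c; [case|exists s].
exists w3 => //.
have G31 : lspan (tgen (~` [set a]) setT) (w3 + (-1) *: w1).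
  apply: lspanD; last exact: lspanZ.
  apply: lspanS G3; apply: tgenS => // c cab ca; apply: cab; by left.
have := H _ _ Gu G31; rewrite scaleN1r addrA -w2E => Hu.
have le1 : nrm2 h (w2 - w1) <= 4 * d'.
  have := nrm2D_le h (- (x - w2)) (x - w1); rewrite nrm2N opprB addrA subrK.
  lra.
have le2 : nrm2 h u <= 4 / eps * d'.
  by rewrite mulrAC ler_pdivlMr// mulrC; exact: le_trans Hu le1.
have -> : x - w3 = (x - w2) + u by rewrite w2E opprD addrA addrAC subrK.
apply: le_lt_trans (nrm2D_le _ _ _) _.
have dE : d = 4 * (1 + 4 / eps) * d'.
  by rewrite /d' [RHS]mulrC divfK// gt_eqF// mulr_gt0// ltr_wpDl// ltW.
rewrite dE; nra.
Qed.

End Processes.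

(** Split [rb = q + n] with [q] in [L2] and [n] orthogonal to [L2]. Orthogonality of the two
    complements puts [n] in [L1], so [q] lies in [L1] and [L2], hence in [W]. As [rb] is orthogonal
    to [W], [q] is null: up to a null vector [rb] is [n], orthogonal to the residual of [ya] in
    [L2]. *)
Lemma resid_perp (R : realType) (V : lmodType R[i]) (h : semihilbert V)
    (L L1 L2 W : set V) (ya yb pa pb : V) :
  closed_subspace h L -> closed_subspace h L1 -> closed_subspace h L2 ->
  L1 `<=` L -> L2 `<=` L -> W `<=` L1 -> W `<=` L2 -> L1 `&` L2 `<=` W ->
  (forall x z, L x -> perp h x L1 -> perp h z L2 -> h x z = 0) ->
  L2 ya -> L1 yb -> is_proj h W ya pa -> is_proj h W yb pb ->
  h (ya - pa) (yb - pb) = 0.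
Proof.
move=> cL c1 c2 L1L L2L W1 W2 cap H La Lb [Wa _] [Wb rbW].
set rb := yb - pb; have rb1 : L1 rb by apply: (csB c1) => //; exact: W1.
have ra2 : L2 (ya - pa) by apply: (csB c2) => //; exact: W2.
have [q [q2 nP]] := projection c2 rb; set n := rb - q in nP.
have [p [p1 mP]] := projection c1 n.
have mn : h (n - p) n = 0.
  apply: H => //; apply: (csB cL); last exact: L1L.
  by apply: (csB cL); [exact: L1L|exact: L2L].
have n1 : L1 n.
  (* [n - p] is orthogonal to [n] by [mn] and to [p] by projection, so it is null. *)
  apply: (cs_null c1 p1); rewrite /nrm2 /rip ip_conj ipBl.
  by rewrite (ip_eq0C mn) (ip_eq0C (mP _ p1)) subrr conjC0.
have qE : q = rb - n by rewrite /n subKr.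
have qW : W q by apply: cap; split=> //; rewrite qE; exact: (csB c1).
have q0 : nrm2 h q = 0.
  by rewrite /nrm2 /rip {1}qE ipBl (rbW _ qW) (nP _ q2) subrr.
apply: ip_eq0C; rewrite -[rb](subrK q) -/n ipDl (nP _ ra2) add0r.
exact: nrm2_eq0_ip.
Qed.

(** * Collider connection and districts *)

Section MixedGraphTheory.
Context {V : finType} (G : mgraph V).
Implicit Types (a b x y : V) (p : seq (ekind * V)).

Lemma DisP x a : reflect (exists2 v, v \in a |: children G a & connect (dashed G) v x)
  (x \in Dis G (a |: children G a)).
Proof.
apply: (iffP finset.bigcupP) => -[v av]; first by rewrite inE => vx; exists v.
by move=> vx; exists v => //; rewrite inE.
Qed.

Lemma connect_dashed_sym : connect_sym (dashed G).
Proof. exact/sym_connect_sym/dashed_sym. Qed.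

(** A collider path whose first edge has a mark at its start consists of dashed edges, possibly
    followed by one final [Bwd] edge out of the endpoint. *)
Lemma collider_path_end x p : mpath G x p -> all_colliders p ->
  ((if p is (e, _) :: _ then mark_src e else true) : bool) ->
  x \in Dis G (mlast x p |: children G (mlast x p)).
Proof.
elim: p x => [|[e y] p IH] x /=.
  by move=> _ _ _; apply/DisP; exists x; rewrite ?setU11 ?connect0.
case/andP=> xy yp; rewrite /all_colliders /= => cp.
have cp' : all_colliders p by exact: path_sorted cp.
case: e xy cp => //= xy cp _.
  (* A [Bwd] edge has a plain tail at its target, so no collider can follow it. *)
  have -> : p = [::] by case: (p) cp.
  by apply/DisP; exists x; rewrite ?connect0// !inE xy orbT.
have /DisP[v v1 v2] : y \in Dis G (mlast y p |: children G (mlast y p)).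
  by apply: IH => //; case: (p) cp => //= -[e z] q /= /andP[].
apply/DisP; exists v => //; apply: connect_trans v2 _.
by rewrite connect_dashed_sym connect1.
Qed.

(** The witness is the dashed path [p] followed by [r]. The edge kind [y] stands for whatever
    precedes the path; carrying it through the induction keeps the collider condition at the
    junction. *)
Lemma dashed_path_colliders x (p : seq V) (y : ekind) z (r : seq (ekind * V)) :
  path (dashed G) x p ->
  mpath G (last x p) r -> sorted (fun e e' => mark_tgt e && mark_src e') (y :: map fst r) ->
  mark_tgt y -> ((if r is (e, _) :: _ then mark_src e else true) : bool) ->
  mlast (last x p) r = z ->
  exists q, [/\ mpath G x q, mlast x q = z &
     sorted (fun e e' => mark_tgt e && mark_src e') (y :: map fst q)].
Proof.
elim: p x y => [|x' p IH] x y /=; first by move=> _ *; exists r.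
case/andP=> xx' px' rp cr y1 r1 rz.
have [||q [q1 q2 q3]] := IH x' Dash px' rp _ _ r1 rz => //.
  by move: cr r1; case: (r) => //= -[e ?] r' /=; rewrite y1 => /andP[_ ->] ->.
by exists ((Dash, x') :: q); split=> /=; rewrite ?xx' ?q1 ?y1.
Qed.

(** The vertices need not differ: the empty path corresponds to [a] lying in its own district. *)
Lemma collider_connectedP a b : collider_connected G a b <->
  Dis G (a |: children G a) :&: Dis G (b |: children G b) != finset.set0.
Proof.
split.
  case=> [[|[e y] p] [ap <- cp]]; apply/set0Pn.
    by exists a; rewrite !inE; apply/andP; split; apply/DisP; exists a;
      rewrite ?setU11 ?connect0.
  (* An edge without a mark at [a] is directed from [a] to a child [y], and the collider condition
     at [y] then supplies the mark needed by [collider_path_end]. *)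
  have [eF|eF] := boolP (mark_src e).
    exists a; rewrite inE collider_path_end// andbT.
    by apply/DisP; exists a; rewrite ?setU11 ?connect0.
  case: e eF ap cp => //= _ /andP[ay yp] cp; exists y; rewrite inE.
  apply/andP; split; first by apply/DisP; exists y; rewrite ?connect0// !inE ay orbT.
  apply: collider_path_end => //; first exact: path_sorted cp.
  by case: (p) cp => //= -[e z] q /= /andP[].
case/set0Pn => x; rewrite inE => /andP[/DisP[v va vx] /DisP[u ub ux]].
have /connectP[p vp uE] : connect (dashed G) v u.
  by apply: connect_trans vx _; rewrite connect_dashed_sym.
subst u; have [r [r1 r2 r3 r4]] : exists r, [/\ mpath G (last v p) r, mlast (last v p) r = b,
    ((if r is (e, _) :: _ then mark_src e else true) : bool) &
    sorted (fun e e' => mark_tgt e && mark_src e') (Dash :: map fst r)].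
  move: ub; rewrite !inE => /orP[/eqP ->|bu]; first by exists [::].
  by exists [:: (Bwd, b)]; split=> //=; rewrite bu.
(* [Dash] is a dummy predecessor: only its mark at the target matters, and [Fwd] has the same mark.
   It is dropped when the path starts at [a] and replaced by [Fwd] when it starts at a child. *)
have [q [q1 q2 q3]] := @dashed_path_colliders v p Dash b r vp r1 r4 isT r3 r2.
move: va; rewrite !inE => /orP[/eqP va|av].
  by exists q; rewrite -va; split=> //; exact: path_sorted q3.
exists ((Fwd, v) :: q); split=> //=; first by rewrite av.
by move: q3; rewrite /all_colliders /=; case: (map fst q).
Qed.

Lemma augmented_disE a b : a != b -> augmented G a b =
  (Dis G (a |: children G a) :&: Dis G (b |: children G b) != finset.set0).
Proof.
by move=> ab; rewrite /= ab; apply/asboolP/idP => /collider_connectedP.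
Qed.

(** Without an edge from [a] to [b], and with no loops, the first step of any path from [a] to [b]
    already enters the complement. Conversely an edge is itself an unseparated path. *)
Lemma separates_rest (H : ugraph V) a b : a != b ->
  ~~ H a b <-> separates H (~: [set a; b])%SET [set a]%SET [set b]%SET.
Proof.
move=> ab; split=> [Hab x p|sep].
  rewrite !inE => /eqP -> {x} pb; case: p pb => [|y p] /=.
    by move=> /eqP ba; rewrite ba eqxx in ab.
  move=> _ /andP[ay _]; rewrite !inE eqxx /=.
  have [ya|ya] := eqVneq y a; first by rewrite ya uedge_irr in ay.
  by have [yb|//] := eqVneq y b; rewrite yb (negPf Hab) in ay.
apply/negP => Hab; have := sep a [:: b].
by rewrite !inE !eqxx /= Hab !inE !eqxx orbT => /(_ isT isT isT).
Qed.

End MixedGraphTheory.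

(** * Spectral lower bound *)

Section SchurComplement.
Context {R : realType}.
Local Notation C := R[i].
Local Open Scope sesquilinear_scope.

Lemma adjmxM m n p (A : 'M[C]_(m, n)) (B : 'M[C]_(n, p)) :
  (A *m B)^t* = B^t* *m A^t*.
Proof. by rewrite trmx_mul map_mxM. Qed.

Lemma adjmxK m n (A : 'M[C]_(m, n)) : A^t*^t* = A.
Proof. by apply/matrixP => i j; rewrite !mxE conjCK. Qed.

(** The inclusion of the coordinates in [A]; it turns blocks into matrix products ([blockmxE]). *)
Definition emb k (A : {set 'I_k}) : 'M[C]_(k, #|A|) :=
  \matrix_(i, j) (i == enum_val j)%:R.

Lemma adjmx_emb k (A : {set 'I_k}) : (emb A)^t* = (emb A)^T.
Proof. by apply/matrixP => i j; rewrite !mxE; case: (_ == _); rewrite ?conjC0 ?conjC1. Qed.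

Lemma emb_mul k (A : {set 'I_k}) n (M : 'M[C]_(k, n)) :
  (emb A)^T *m M = \matrix_(i, j) M (enum_val i) j.
Proof.
apply/matrixP => i j; rewrite !mxE (bigD1 (enum_val i))//= !mxE eqxx mul1r.
by rewrite big1 ?addr0// => l /negPf li; rewrite !mxE li mul0r.
Qed.

Lemma mul_emb k (A : {set 'I_k}) n (M : 'M[C]_(n, k)) :
  M *m emb A = \matrix_(i, j) M i (enum_val j).
Proof.
apply/matrixP => i j; rewrite !mxE (bigD1 (enum_val j))//= !mxE eqxx mulr1.
by rewrite big1 ?addr0// => l /negPf li; rewrite !mxE li mulr0.
Qed.

Lemma blockmxE k (M : 'M[C]_k) (A B : {set 'I_k}) :
  blockmx M A B = (emb A)^T *m M *m emb B.
Proof. by rewrite emb_mul mul_emb; apply/matrixP => i j; rewrite !mxE. Qed.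

Lemma emb_id k (A : {set 'I_k}) : (emb A)^T *m emb A = 1%:M.
Proof.
rewrite emb_mul; apply/matrixP => i j; rewrite !mxE.
by rewrite (inj_eq enum_val_inj).
Qed.

Lemma emb_setC k (A : {set 'I_k}) :
  emb A *m (emb A)^T + emb (~: A)%SET *m (emb (~: A)%SET)^T = 1%:M.
Proof.
have H (B : {set 'I_k}) i j :
    (emb B *m (emb B)^T) i j = ((i == j) && (i \in B))%:R :> C.
  rewrite !mxE; have [iB|iB] := boolP (i \in B); last first.
    rewrite andbF big1// => l _; rewrite !mxE; case: eqP => [il|_]; last by rewrite mul0r.
    by rewrite il enum_valP in iB.
  rewrite (bigD1 (enum_rank_in iB i))//= !mxE enum_rankK_in// eqxx mul1r andbT.
  rewrite big1 ?addr0 1?eq_sym// => l li; rewrite !mxE; case: eqP => [il|_]; last by rewrite mul0r.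
  by move: li; rewrite (_ : l = enum_rank_in iB i) ?eqxx//; apply: enum_val_inj;
    rewrite enum_rankK_in.
apply/matrixP => i j; rewrite mxE !H !mxE finset.in_setC.
by case: (i == j); case: (i \in A); rewrite /= ?addr0 ?add0r.
Qed.

Lemma herm_adj n (M : 'M[C]_n) : M \is hermsymmx -> M^t* = M.
Proof. by move=> /is_hermitianmxP; rewrite expr0 scale1r => <-. Qed.

Lemma adjmx_quadD n (M : 'M[C]_n) (p q : 'cV[C]_n) :
  p^t* *m M *m q = 0 -> q^t* *m M *m p = 0 ->
  (p + q)^t* *m M *m (p + q) = p^t* *m M *m p + q^t* *m M *m q.
Proof.
move=> pq qp; rewrite (_ : (p + q)^t* = p^t* + q^t*).
  by rewrite !mulmxDl !mulmxDr pq qp addr0 add0r.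
by apply/matrixP => a b; rewrite !mxE rmorphD.
Qed.

Lemma pdmx_ge0 n (M : 'M[C]_n) (x : 'cV[C]_n) : pdmx M -> 0 <= (x^t* *m M *m x) 0 0.
Proof.
move=> [_ H]; have [->|x0] := eqVneq x 0; first by rewrite mulmx0 mxE.
exact/ltW/H.
Qed.

(** A nonzero vector of the left kernel would make the quadratic form vanish. *)
Lemma pdmx_unit n (M : 'M[C]_n) : pdmx M -> M \in unitmx.
Proof.
move=> [_ H]; rewrite -row_free_unit -kermx_eq0; apply/eqP/row_matrixP => i.
rewrite row0; set v := row i _; have vM : v *m M = 0.
  by rewrite -row_mul mulmx_ker row0.
apply/eqP; apply: contraT => v0; have v0' : v^t* != 0.
  apply: contra v0 => /eqP vt; rewrite -[v]adjmxK vt; apply/eqP/matrixP => a b.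
  by rewrite !mxE conjC0.
by have := H _ v0'; rewrite adjmxK vM mul0mx mxE ltxx.
Qed.

Lemma pdmx_block n (M : 'M[C]_n) (A : {set 'I_n}) : pdmx M -> pdmx (blockmx M A A).
Proof.
move=> [hM H]; split.
  apply/is_hermitianmxP; rewrite expr0 scale1r blockmxE.
  have EK : (emb A)^T^t* = emb A by rewrite -adjmx_emb adjmxK.
  by rewrite !adjmxM adjmx_emb EK (herm_adj hM) mulmxA.
move=> x x0; have := H (emb A *m x); rewrite adjmxM adjmx_emb blockmxE !mulmxA; apply.
apply: contra x0 => /eqP Ax; rewrite -[x]mul1mx -(emb_id A) -mulmxA Ax mulmx0.
by [].
Qed.

(* With [z0] the Schur projection of the [A]-columns along the complementary
   columns, [x^* M x = xi^* (M_AA - M_AB M_BB^-1 M_BA) xi + y^* M_BB y]. *)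
Lemma schur_complement_le n (M : 'M[C]_n) (A : {set 'I_n}) (x : 'cV[C]_n) :
  pdmx M ->
  (((emb A)^T *m x)^t* *m (blockmx M A A - blockmx M A (~: A)%SET *m
      invmx (blockmx M (~: A)%SET (~: A)%SET) *m blockmx M (~: A)%SET A)
     *m ((emb A)^T *m x)) 0 0 <= (x^t* *m M *m x) 0 0.
Proof.
move=> pdM; set B := (~: A)%SET; set xi := _ *m x; have [hM _] := pdM; have MH := herm_adj hM.
have pdB := pdmx_block B pdM.
have uB := pdmx_unit pdB.
set be := blockmx M B B in uB pdB *; set r' := blockmx M B A.
pose z0 := emb A - emb B *m (invmx be *m r').
have Bz0 : (emb B)^T *m M *m z0 = 0.
  by rewrite mulmxBr mulmxA -!blockmxE mulmxA mulmxV// mul1mx subrr.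
have z0B : z0^t* *m M *m emb B = 0.
  rewrite -[emb B]adjmxK adjmx_emb -[M]MH -!adjmxM mulmxA Bz0.
  by apply/matrixP => a b; rewrite !mxE conjC0.
pose y := (emb B)^T *m x + invmx be *m r' *m xi.
have splitx : x = emb A *m xi + emb B *m ((emb B)^T *m x).
  by rewrite !mulmxA -mulmxDl emb_setC mul1mx.
have xE : x = z0 *m xi + emb B *m y.
  rewrite [LHS]splitx /z0 /y mulmxBl mulmxDr addrACA -(mulmxA (emb B) _ xi).
  by rewrite addNr addr0.
have qE : x^t* *m M *m x = xi^t* *m (z0^t* *m M *m z0) *m xi + y^t* *m be *m y.
  rewrite xE adjmx_quadD.
  - by rewrite (adjmxM z0 xi) (adjmxM (emb B) y) adjmx_emb /be blockmxE !mulmxA.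
  - by rewrite (adjmxM z0 xi) mulmxA -(mulmxA (xi^t*)) -(mulmxA (xi^t*)) z0B mulmx0 mul0mx.
  by rewrite (adjmxM (emb B) y) adjmx_emb mulmxA -(mulmxA (y^t*)) -(mulmxA (y^t*)) Bz0
    mulmx0 mul0mx.
have z0q : z0^t* *m M *m z0 =
    blockmx M A A - blockmx M A B *m invmx be *m r'.
  have adjB m p (X Y : 'M[C]_(m, p)) : (X - Y)^t* = X^t* - Y^t*.
    by apply/matrixP => a b; rewrite !mxE rmorphB.
  rewrite {1}/z0 adjB (adjmxM (emb B)) !adjmx_emb !mulmxBl.
  rewrite -(mulmxA _ (emb B)^T M) -(mulmxA _ ((emb B)^T *m M) z0) Bz0 mulmx0 subr0.
  by rewrite /z0 mulmxBr mulmxA -!blockmxE mulmxA.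
rewrite qE z0q [leRHS]mxE.
by rewrite lerDl pdmx_ge0.
Qed.

Lemma quad_scalar n (c : C) (x : 'cV[C]_n) :
  (x^t* *m c%:M *m x) 0 0 = c * \sum_i (x i 0)^* * x i 0.
Proof.
rewrite mul_mx_scalar -scalemxAl mxE; congr (_ * _).
by rewrite mxE; apply: eq_bigr => i _; rewrite !mxE.
Qed.

Lemma psdmx_scalar n (c : C) : 0 <= c -> psdmx (c%:M : 'M[C]_n).
Proof.
move=> c0; split=> [|x].
  apply/is_hermitianmxP; rewrite expr0 scale1r tr_scalar_mx map_scalar_mx /=.
  by rewrite (CrealP (ger0_real c0)).
rewrite quad_scalar mulr_ge0// sumr_ge0// => i _.
by rewrite mulrC mul_conjC_ge0.
Qed.

(** * Coherence of a single coordinate with all the others, where the [A]-blocks are scalars *)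

Section Singleton.
Variables (n : nat) (M : 'M[C]_n) (a : 'I_n) (eps : R).
Hypothesis pdM : pdmx M.
Let A := [set a]%SET.
Let B := (~: A)%SET.
Let i0 : 'I_#|A| := cast_ord (esym (cards1 a)) ord0.

Let i0P (i : 'I_#|A|) : i = i0.
Proof.
apply/val_inj/eqP => /=; have := ltn_ord i.
by rewrite [X in (_ < X)%N]cards1 ltnS leqn0.
Qed.

Let scalarE (X : 'M[C]_#|A|) : X = (X i0 i0)%:M.
Proof. by apply/matrixP => i j; rewrite (i0P i) (i0P j) [RHS]mxE eqxx. Qed.

Let enum_i0 : enum_val i0 = a.
Proof. by have := enum_valP i0; rewrite inE => /eqP. Qed.

Let sum_i0 (F : 'I_#|A| -> C) : \sum_i F i = F i0.
Proof.
by rewrite (bigD1 i0)//= big1 ?addr0// => i; rewrite (i0P i) eqxx.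
Qed.

Let q := (blockmx M A B *m invmx (blockmx M B B) *m blockmx M B A) i0 i0.

Lemma pdmx_diag_gt0 : 0 < M a a.
Proof.
have [_ H] := pdM; have d0 : (delta_mx a 0 : 'cV[C]_n) != 0.
  by apply/eqP => /matrixP/(_ a 0); rewrite !mxE !eqxx => /eqP; rewrite oner_eq0.
have := H _ d0; rewrite (_ : (delta_mx a 0)^t* = delta_mx 0 a); last first.
  by apply/matrixP => i j; rewrite !mxE andbC; case: (_ && _); rewrite ?conjC0 ?conjC1.
by rewrite -mulmxA -colE -rowE !mxE.
Qed.

Let block_diag : blockmx M A A = (M a a)%:M.
Proof. by rewrite [LHS]scalarE mxE enum_i0. Qed.

Hypothesis coherent : loewner_le (coherencemx M A B) ((1 - eps)%:C)%:M.

(** The coherence matrix is the scalar [q / M a a], so its bound [1 - eps] leaves at least [eps]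
    times [M a a] for the Schur complement. *)
Let schur_gap : eps%:C * M a a <= M a a - q.
Proof.
have m0 := pdmx_diag_gt0; set m := M a a in m0 *.
set s := invsqrtmx (blockmx M A A).
have [_ ss] : psdmx s /\ s *m s = (m^-1)%:M.
  rewrite /s /invsqrtmx block_diag invmx_scalar -/m.
  apply: (@xgetPex _ 0 [set S : 'M[C]_#|A| | psdmx S /\ S *m S = (m^-1)%:M]).
  (* An explicit root shows that the choice behind [invsqrtmx] succeeds. Only the square of the
     chosen root enters below. *)
  exists (sqrtC m^-1)%:M; split.
    by apply: psdmx_scalar; rewrite sqrtC_ge0 invr_ge0 ltW.
  by rewrite -scalar_mxM -expr2 sqrtCK.
have cc : s i0 i0 * s i0 i0 = m^-1.
  by move: ss; rewrite {1 2}[s]scalarE -scalar_mxM => /matrixP/(_ i0 i0); rewrite !mxE eqxx.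
have cohE : coherencemx M A B = (m^-1 * q)%:M.
  rewrite /coherencemx -/s [s]scalarE -!(mulmxA (s i0 i0)%:M) mul_scalar_mx mul_mx_scalar.
  by rewrite scalerA cc [X in _ *: X]scalarE -/q scale_scalar_mx.
have [_ /(_ (const_mx 1))] := coherent.
rewrite cohE -raddfB /= quad_scalar sum_i0 !mxE conjC1 !mulr1.
rewrite -(pmulr_rge0 _ m0) mulrBr mulrA mulfV ?gt_eqF// mul1r rmorphB /= mulrBr mulr1.
rewrite [_ * eps%:C]mulrC -subr_ge0 => H.
by rewrite -subr_ge0; move: H; congr (0 <= _); rewrite subr0 addrAC.
Qed.

Lemma coherence_quad_le (x : 'cV[C]_n) :
  eps%:C * (M a a * ((x a 0)^* * x a 0)) <= (x^t* *m M *m x) 0 0.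
Proof.
apply: le_trans (schur_complement_le A x pdM).
rewrite block_diag [X in (_ - X)](scalarE) -/q -raddfB /= quad_scalar sum_i0.
rewrite emb_mul mxE enum_i0 mulrA ler_wpM2r ?schur_gap//.
by rewrite mulrC mul_conjC_ge0.
Qed.

End Singleton.

End SchurComplement.

(** * Norms of linear combinations in the spectral domain, and the integrated coherence bound *)

Section SpectralBound.
Context {d : measure_display} {T : measurableType d} {R : realType}.
Context {P : probability T R} {k : nat}.
Variable Y : 'I_k -> R -> {RV P >-> R}.
Variable f : R -> 'M[R[i]]_k.
Hypothesis Y_stationary : wide_sense_stationary Y.
Hypothesis f_density : spectral_density Y f.
Hypothesis f_pd : forall l : R, pdmx (f l).
Local Open Scope sesquilinear_scope.

Notation h := (cl2_semihilbert P).

Lemma crv_cL2 a t : cL2 P (crv Y a t).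
Proof.
have [YL _ _] := Y_stationary; split=> /=; first exact: YL.
by apply: Lfun_cst.
Qed.

Definition cl2rv a t : cl2 P := mkcl2 (crv_cL2 a t).

Lemma cisB (s t : R) : cis (s - t) = cis s * (cis t)^*.
Proof. by apply: complexP; rewrite ReImE /= ?cosB ?sinB; ring. Qed.

Lemma cintegrable_cis_mul (g : R -> R[i]) u : cintegrable lebesgue_measure g ->
  cintegrable lebesgue_measure (fun l : R => cis (l * u) * g l).
Proof.
move=> [rg ig].
have mc : measurable_fun [set: R] (fun l : R => cos (l * u)).
  apply: (measurableT_comp (continuous_measurable_fun (@continuous_cos R))).
  exact: measurable_funM.
have ms : measurable_fun [set: R] (fun l : R => sin (l * u)).
  apply: (measurableT_comp (continuous_measurable_fun (@continuous_sin R))).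
  exact: measurable_funM.
have bd (w : R -> R) : (forall x, `|w x| <= 1) -> [bounded w (l * u) | l in [set: R]].
  by move=> w1; exists 1; split=> // M M1 l _ /=; apply: le_trans (w1 _) (ltW M1).
have c1 x : `|cos x| <= 1 :> R by rewrite ler_norml cos_geN1 cos_le1.
have s1 x : `|sin x| <= 1 :> R by rewrite ler_norml sin_geN1 sin_le1.
have I := fun w g mw (w1 : forall x, `|w x| <= 1) ig =>
  @integrableMr _ _ _ lebesgue_measure setT measurableT (fun l => w (l * u)) g mw (bd w w1) ig.
split.
  have := integrableB measurableT (I cos _ mc c1 rg) (I sin _ ms s1 ig).
  by apply: eq_integrable => // l _; rewrite /= ReM.
have := integrableD measurableT (I cos _ mc c1 ig) (I sin _ ms s1 rg).
by apply: eq_integrable => // l _; rewrite /= ImM.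
Qed.

(** The process is real, so conjugation disappears, and stationarity moves the times to [s - t] and
    [0], where the spectral density applies. *)
Lemma ip_cl2rv a b s t : h (cl2rv a s) (cl2rv b t) =
  cintegral lebesgue_measure (fun l : R => cis (l * (s - t)) * f l a b).
Proof.
have [_ _ st] := Y_stationary; have [_ fE] := f_density; rewrite -fE.
have := st a b (s - t) 0 t; rewrite subrK add0r => <-.
transitivity (cintegral P (fun w => (Y a s w * Y b t w)%:C)).
  congr (cintegral P _); apply/funext => w.
  by apply: complexP; rewrite !ReImE /=; ring.
apply: complexP; first by rewrite unlock.
by rewrite /= /Rintegral integral0.
Qed.

Section LinearCombination.
Context {J : finType}.
Variables (v : J -> 'I_k) (t : J -> R).
Implicit Types c : J -> R[i].

Definition lincomb c : cl2 P := \sum_j c j *: cl2rv (v j) (t j).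

(** In the spectral domain [Y_a(t)] becomes [cis (l t)] in coordinate [a]. The conjugate is there
    because [quad] takes the adjoint of this column on the left. *)
Definition transfer c l : 'cV[R[i]]_k :=
  \col_a (\sum_(j | v j == a) c j * cis (l * t j))^*.

Definition quad c l : R[i] := ((transfer c l)^t* *m f l *m transfer c l) 0 0.

Lemma quadE c l : quad c l = \sum_j \sum_i (c j * (c i)^*) *
  (cis (l * (t j - t i)) * f l (v j) (v i)).
Proof.
pose w a := \sum_(j | v j == a) c j * cis (l * t j).
have -> : quad c l = \sum_a \sum_b w a * f l a b * (w b)^*.
  rewrite /quad mxE exchange_big /=; apply: eq_bigr => b _.
  rewrite mxE mulr_suml; apply: eq_bigr => a _.
  by rewrite !mxE conjCK.
rewrite [RHS](partition_big v predT)//=; apply: eq_bigr => a _.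
have -> : \sum_b w a * f l a b * (w b)^* =
    \sum_(j | v j == a) \sum_b c j * cis (l * t j) * f l a b * (w b)^*.
  rewrite exchange_big /=; apply: eq_bigr => b _.
  by rewrite -!mulr_suml.
apply: eq_bigr => j /eqP va.
rewrite [RHS](partition_big v predT)//=; apply: eq_bigr => b _.
rewrite /w rmorph_sum mulr_sumr; apply: eq_bigr => i /eqP vb.
by rewrite va vb mulrBr cisB rmorphM /=; ring.
Qed.

Lemma ip_lincomb c : h (lincomb c) (lincomb c) = cintegral lebesgue_measure (quad c).
Proof.
have suml (u : J -> cl2 P) z : h (\sum_j c j *: u j) z = \sum_j c j * h (u j) z.
  by elim/big_rec2: _ => [|j x y _ <-]; [exact: ip0l|rewrite ip_linear].
have sumr (u : J -> cl2 P) z : h z (\sum_j c j *: u j) = \sum_j (c j)^* * h z (u j).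
  rewrite ip_conj suml rmorph_sum; apply: eq_bigr => j _.
  by rewrite rmorphM [in RHS]ip_conj.
have ic j i : cintegrable lebesgue_measure
    (fun l : R => cis (l * (t j - t i)) * f l (v j) (v i)).
  by apply: cintegrable_cis_mul; case: f_density.
rewrite (funext (quadE c)) cintegral_sum => [|j]; last first.
  by apply: cintegrable_sum => i; exact: cintegrableZ.
rewrite /lincomb suml; apply: eq_bigr => j _.
rewrite sumr mulr_sumr cintegral_sum => [|i]; last exact: cintegrableZ.
by apply: eq_bigr => i _; rewrite cintegralZ// ip_cl2rv mulrA.
Qed.

Lemma quad_integrable c : lebesgue_measure.-integrable [set: R]
  (fun l => (complex.Re (quad c l))%:E).
Proof.
suff [] : cintegrable lebesgue_measure (quad c) by [].
rewrite (funext (quadE c)); apply: cintegrable_sum => j; apply: cintegrable_sum => i.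
by apply: cintegrableZ; apply: cintegrable_cis_mul; case: f_density.
Qed.

Lemma nrm2_lincomb c : (nrm2 h (lincomb c))%:E =
  (\int[lebesgue_measure]_l (complex.Re (quad c l))%:E)%E.
Proof.
rewrite /nrm2 /rip ip_lincomb /= /Rintegral fineK//.
exact: integrable_fin_num (quad_integrable c).
Qed.

Lemma quad_ge0 c l : 0 <= complex.Re (quad c l).
Proof. by have := pdmx_ge0 (transfer c l) (f_pd l); rewrite lecE => /andP[]. Qed.

Lemma quad_single c a l : quad (fun j => if v j == a then c j else 0) l =
  f l a a * ((transfer c l a 0)^* * transfer c l a 0).
Proof.
rewrite /quad (_ : transfer _ l = transfer c l a 0 *: delta_mx a 0).
  set z := transfer c l a 0.
  rewrite (_ : _^t* = z^* *: delta_mx 0 a); last first.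
    apply/matrixP => i j; rewrite !mxE rmorphM /= andbC.
    by case: (_ && _); rewrite ?conjC0 ?conjC1.
  by rewrite -scalemxAr -!scalemxAl mxE mxE -rowE -colE !mxE; ring.
apply/matrixP => b j; rewrite (ord1 j) !mxE eqxx andbT.
have [->|ba] := eqVneq b a; rewrite ?mulr1 ?mulr0.
  by rewrite (eq_bigr (fun i => c i * cis (l * t i))) // => i ->.
rewrite big1 ?conjC0// => i /eqP ->.
by rewrite (negPf ba) mul0r.
Qed.

(** Dropping the coordinates other than [a] leaves entry [a] of the transfer vector unchanged
    ([quad_single]), so [coherence_quad_le] holds between the integrands at almost every frequency
    and can be integrated. *)
Lemma coherence_lincomb c a (eps : R) : 0 < eps ->
  {ae lebesgue_measure, forall l : R,
     loewner_le (coherencemx (f l) [set a]%SET (~: [set a])%SET) ((1 - eps)%:C)%:M} ->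
  eps * nrm2 h (lincomb (fun j => if v j == a then c j else 0)) <= nrm2 h (lincomb c).
Proof.
move=> eps0 coh; rewrite -lee_fin EFinM !nrm2_lincomb.
rewrite -integralZl//; last exact: quad_integrable.
have mq c0 : measurable_fun [set: R] (fun l => (complex.Re (quad c0 l))%:E).
  by have /integrableP[] := quad_integrable c0.
apply: ae_ge0_le_integral => //.
- by move=> l _; rewrite mule_ge0 ?lee_fin ?quad_ge0// ltW.
- by apply: emeasurable_funM => //; exact: mq.
- by move=> l _; rewrite lee_fin quad_ge0.
- exact: mq.
have [N [mN N0 sub]] := coh; exists N; split=> // l; apply: contra_notP => Nl _.
have {}coh := contrapT (fun H => Nl (sub l H)).
rewrite -EFinM lee_fin quad_single.
have := coherence_quad_le (f_pd l) coh (transfer c l).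
by rewrite lecE => /andP[_]; rewrite [leLHS]ReM /= mul0r subr0.
Qed.

End LinearCombination.

Lemma coherence_lspan a (eps : R) u w : 0 < eps ->
  {ae lebesgue_measure, forall l : R,
     loewner_le (coherencemx (f l) [set a]%SET (~: [set a])%SET) ((1 - eps)%:C)%:M} ->
  lspan (tgen cl2rv [set a] setT) u -> lspan (tgen cl2rv (~` [set a]) setT) w ->
  eps * nrm2 h u <= nrm2 h (u + w).
Proof.
move=> eps0 coh [n [c [u' [Gu ->]]]] [m [e [w' [Gw ->]]]].
have /choice[s us] : forall i, exists s, u' i = cl2rv a s.
  by move=> i; have [_ -> [s _ <-]] := Gu i; exists s.
have /choice[p wp] : forall i, exists p, p.1 != a /\ w' i = cl2rv p.1 p.2.
  by move=> i; have [b /eqP ba [r _ <-]] := Gw i; exists (b, r).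
(* Both combinations are merged over a sum type; as the terms of [w] avoid [a], keeping only
   [v j == a] recovers [u]. *)
pose v (j : 'I_n + 'I_m) := match j with inl _ => a | inr i => (p i).1 end.
pose t (j : 'I_n + 'I_m) := match j with inl i => s i | inr i => (p i).2 end.
pose g (j : 'I_n + 'I_m) := match j with inl i => c i | inr i => e i end.
have := @coherence_lincomb _ v t g a eps eps0 coh.
have -> : lincomb v t (fun j => if v j == a then g j else 0) = \sum_i c i *: u' i.
  rewrite /lincomb big_sumType /= [X in _ + X]big1 ?addr0 => [|i _]; last first.
    by rewrite (negPf (proj1 (wp i))) scale0r.
  by apply: eq_bigr => i _; rewrite eqxx us.
suff -> : lincomb v t g = \sum_i c i *: u' i + \sum_i e i *: w' i by [].
rewrite /lincomb big_sumType /=; congr (_ + _); apply: eq_bigr => i _.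
  by rewrite us.
by rewrite (proj2 (wp i)).
Qed.

End SpectralBound.

(** * Partial correlation and the causality graph *)

Section Stationary.
Context {d : measure_display} {T : measurableType d} {R : realType}.
Context {P : probability T R} {k : nat}.
Variable Y : 'I_k -> R -> {RV P >-> R}.
Hypothesis Y_stationary : wide_sense_stationary Y.
Hypothesis Y_pnd : purely_nondeterministic Y.

Local Notation h := (cl2_semihilbert P).
Local Notation y := (cl2rv Y_stationary).

Lemma crv_set_cL2 (C : set 'I_k) (S : set R) :
  [set crv Y c s | c in C & s in S] `<=` cL2 P.
Proof. by move=> _ [c _ [s _ <-]]; exact: crv_cL2. Qed.

Lemma cval_crv_set (C : set 'I_k) (S : set R) :
  @cval _ _ _ P @^-1` [set crv Y c s | c in C & s in S] = tgen y C S.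
Proof.
apply/seteqP; split=> [x [c Cc [s Ss cs]]|_ [c Cc [s Ss <-]]].
  by exists c => //; exists s => //; apply: cl2_inj.
by exists c => //; exists s.
Qed.

Lemma closed_span_tspan (C : set 'I_k) (S : set R) x :
  closed_span P [set crv Y c s | c in C & s in S] (cval x) <-> tspan h y C S x.
Proof. by rewrite /tspan -cval_crv_set; apply: closed_span_cval; exact: crv_set_cL2. Qed.

(** Packs [resid] as a vector of [cl2], so that the abstract theory of projections applies to it. *)
Lemma resid_cval (C : set 'I_k) (S : set R) x :
  exists2 r, cval r = resid P (closed_span P [set crv Y c s | c in C & s in S]) (cval x) &
    is_proj h (tspan h y C S) x (x - r).
Proof.
have [p pE pP] := proj_is_proj x (@crv_set_cL2 C S).
exists (x - p); last by rewrite subKr /tspan -cval_crv_set.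
by apply/funext => w; rewrite /resid -pE.
Qed.

Lemma set_of_setC1 (a : 'I_k) : [set` (~: [set a])%SET] = ~` [set a].
Proof. by apply/seteqP; split=> c /=; rewrite !inE => /eqP. Qed.

Lemma set_of_setC2 (a b : 'I_k) : [set` (~: [set a; b])%SET] = ~` [set a; b].
Proof.
apply/seteqP; split=> c /=; rewrite !inE negb_or.
  by move=> /andP[/eqP ca /eqP cb] [].
by move=> cab; apply/andP; split; apply/eqP => cE; apply: cab; [left|right].
Qed.

Lemma set_of_set1 (a : 'I_k) : [set` [set a]%SET] = [set a].
Proof. by apply/seteqP; split=> c /=; rewrite !inE => /eqP. Qed.

Lemma set_of_setT : [set` [set: 'I_k]%SET] = [set: 'I_k].
Proof. by apply/seteqP; split=> c /=; rewrite ?inE. Qed.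

Lemma cval_Lat (C : {set 'I_k}) c t : c \in C -> Lat Y C t (cval (y c t)).
Proof.
move=> cC; apply/closed_span_cval; first by move=> _ [b _ <-]; exact: crv_cL2.
by apply: sub_clspan; exists c.
Qed.

(** Pure non-determinism makes [x] vanish almost surely, hence have seminorm zero. *)
Lemma remote_past_null x :
  (forall t, tspan h y setT [set s | s <= t] x) -> nrm2 h x = 0.
Proof.
move=> Fx; have : (\bigcap_(t in [set: R]) Lpast Y [set: 'I_k]%SET t) (cval x).
  by move=> t _; rewrite /Lpast set_of_setT; apply/closed_span_tspan.
rewrite Y_pnd => -[Lx x0]; apply/EFin_inj; rewrite [LHS]cinner_self//.
have [mr mi] := cL2_msq Lx.
rewrite (_ : 0%:E = \int[P]_w (cst 0%E w))%E; last by rewrite integral0.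
apply: ae_eq_integral => //.
  by under eq_fun do rewrite EFinD; exact: emeasurable_funD.
by move: x0; apply: filterS => w -> _; rewrite /= expr0n /= addr0.
Qed.

(* By non-causality, the projection on the past of [V \ {a}] is also the
   projection on the past of [V]. *)
Lemma granger_innovation a v s t p : v != a -> granger_noncausal Y a v -> 0 <= s <= 1 ->
  is_proj h (tspan h y setT [set r | r <= t]) (y v (t + s)) p ->
  tspan h y (~` [set a]) setT (y v (t + s) - p).
Proof.
move=> va noncausal s01 pP.
have ga := noncausal s t s01; rewrite /Lpast set_of_setC1 set_of_set1 in ga.
have [r rE rP] := resid_cval (~` [set a]) [set r | r <= t] (y v (t + s)).
set M := tspan h y (~` [set a]) [set r | r <= t] in rP *.
have MF : M `<=` tspan h y setT [set r | r <= t] by exact: tspanS.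
have [Mr rM] := rP; rewrite subKr in rM.
have rF : is_proj h (tspan h y setT [set r | r <= t]) (y v (t + s)) (y v (t + s) - r).
  split; first exact: MF.
  rewrite subKr; apply: perp_clspan => _ [c _ [u ut <-]].
  (* The only generators of the full past outside [M] are those of [a]. Such a generator may be
     replaced by its residual given [M], since [r] is orthogonal to [M]; non-causality then
     applies. *)
  have [->|/eqP ca] := eqVneq c a; last by apply: rM; exact: tspan_gen.
  have [ra raE [Mra _]] := resid_cval (~` [set a]) [set r | r <= t] (y a u).
  rewrite -(subrK ra (y a u)) ipDr (rM _ Mra) add0r.
  have := ga (cval (y v (t + s))) (cval (y a u)); rewrite -rE -raE; apply.
    by apply: cval_Lat; rewrite inE.
  by apply/closed_span_tspan; exact: tspan_gen.
have cL := tspan_closed h y (~` [set a]) setT.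
apply: (@cs_null _ _ _ _ cL r).
  rewrite -(subKr (y v (t + s)) r); apply: (csB cL); first by apply: tspan_gen => //; exact/eqP.
  by apply: (tspanS (C := ~` [set a]) (S := [set r | r <= t])) Mr.
have <- := is_proj_uniq (tspan_closed _ _ _ _) rF pP.
by congr (nrm2 _ _); rewrite addrAC.
Qed.

(** * From disjoint unions of districts to vanishing partial correlation *)

Section Separation.
Variables (f : R -> 'M[R[i]]_k) (eps : R) (a b : 'I_k).
Hypothesis f_density : spectral_density Y f.
Hypothesis f_pd : forall l : R, pdmx (f l).
Hypothesis eps0 : 0 < eps.
Hypothesis coherent : {ae lebesgue_measure, forall l : R,
  loewner_le (coherencemx (f l) [set a]%SET (~: [set a])%SET) ((1 - eps)%:C)%:M}.

Let GC := causality_graph Y.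
Let A := [set` Dis GC (a |: children GC a)].
Let B := [set` Dis GC (b |: children GC b)].
Hypothesis AB0 : A `&` B = set0.

Lemma noncausal_outside c v : v \notin Dis GC (c |: children GC c) ->
  v != c /\ granger_noncausal Y c v.
Proof.
move=> vD; have {}vD : v \notin c |: children GC c.
  by apply: contra vD => vc; apply/DisP; exists v => //; exact: connect0.
move: vD; rewrite !inE negb_or => /andP[vc nc]; split=> //.
by move: nc; rewrite /= eq_sym vc /= negbK => /asboolP.
Qed.

(** A dashed edge between [v] and [w] would put [w] in the district of [v], hence in [A]. *)
Lemma uncorrelated_districts v w : A v -> ~ A w -> contemp_uncorrelated Y v w.
Proof.
move=> Av Aw; have vw : v != w by apply/eqP => vw; apply: Aw; rewrite -vw.
apply: contrapT => nc; apply: Aw; move: Av => /DisP[c ca cv]; apply/DisP.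
exists c => //; apply: connect_trans cv (connect1 _) => /=.
by rewrite vw; apply/asboolPn.
Qed.

Lemma separated_partial_uncorrelated : partial_uncorrelated Y a b.
Proof.
have innovation v t s : exists e,
    cval e = resid P (Lpast Y [set: 'I_k]%SET t) (crv Y v (t + s)) /\
    is_proj h (tspan h y setT [set r | r <= t]) (y v (t + s)) (y v (t + s) - e).
  have [r rE rP] := resid_cval setT [set r | r <= t] (y v (t + s)).
  by exists r; rewrite /Lpast set_of_setT.
pose e v t s := projT1 (cid (innovation v t s)).
have eE v t s : cval (e v t s) = resid P (Lpast Y [set: 'I_k]%SET t) (crv Y v (t + s)).
  by rewrite /e; case: cid => ? [].
have eP v t s :
    is_proj h (tspan h y setT [set r | r <= t]) (y v (t + s)) (y v (t + s) - e v t s).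
  by rewrite /e; case: cid => ? [].
(* Used with [c = a] for [v] outside [A], and with [c = b] for [v] in [A], which is then outside
   [B]. *)
have e_outside c v t s : v \notin Dis GC (c |: children GC c) -> 0 <= s <= 1 ->
    tspan h y (~` [set c]) setT (e v t s).
  move=> /noncausal_outside[vc nc] s01.
  by have := granger_innovation vc nc s01 (eP v t s); rewrite subKr.
have notB v : A v -> v \notin Dis GC (b |: children GC b).
  by move=> Av; apply/negP => Bv; have : (A `&` B) v by []; rewrite AB0.
(* The complements of the spans without [a] and without [b] are orthogonal: the abstract innovation
   argument, fed with non-causality, absent dashed edges and pure non-determinism. *)
have dual x z : tspan h y setT setT x -> perp h x (tspan h y (~` [set a]) setT) ->
    perp h z (tspan h y (~` [set b]) setT) -> h x z = 0.
  move=> xV xa zb; apply: (perp_of_innovations (A := A) (e := e)) xV _ _.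
  - by move=> v t s _; exact: eP.
  - move=> v w t s s' Av Aw s01 s'01.
    have := uncorrelated_districts Av Aw s01 s'01 (t := t).
    move=> /(_ (cval (y v (t + s))) (cval (y w (t + s')))); rewrite -!eE; apply.
      by apply: cval_Lat; rewrite inE.
    by apply: cval_Lat; rewrite inE.
  - exact: remote_past_null.
  - by move=> v t s /negP Av s01; apply: xa; exact: e_outside.
  - by move=> v t s Av s01; apply: zb; apply: e_outside => //; exact: notB.
(* Every vertex lies in its own union of districts, so disjointness separates [a] from [b]. *)
have ab : a <> b.
  move=> ab; have : (A `&` B) a; last by rewrite AB0.
  by split; apply/DisP; exists a; rewrite ?ab ?setU11 ?connect0.
have cap := tspan_cap eps0 (fun u w => coherence_lspan (Y_stationary := Y_stationary)
  f_density f_pd eps0 coherent (u := u) (w := w)) (b := b).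
have cT C := tspan_closed h y C setT.
move=> t; rewrite /Lall set_of_setC2.
have [ra raE raP] := resid_cval (~` [set a; b]) setT (y a t).
have [rb rbE rbP] := resid_cval (~` [set a; b]) setT (y b t).
rewrite -[crv Y a t]/(cval (y a t)) -[crv Y b t]/(cval (y b t)) -raE -rbE.
have := resid_perp (cT setT) (cT (~` [set a])) (cT (~` [set b])) _ _ _ _ cap dual
  (tspan_gen _ _ _ _) (tspan_gen _ _ _ _) raP rbP.
rewrite !subKr; apply => //.
- exact: tspanS.
- exact: tspanS.
- by apply: tspanS => // c cab ca; apply: cab; left.
- by apply: tspanS => // c cab cb; apply: cab; right.
- by move=> /= /esym.
Qed.

End Separation.
End Stationary.

Local Close Scope classical_set_scope.

Theorem lemma4p14 (d : measure_display) (T : measurableType d) (R : realType)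
    (P : probability T R) (k : nat) (Y : 'I_k -> R -> {RV P >-> R})
    (f : R -> 'M[R[i]]_k)
    (Y_stationary : wide_sense_stationary Y)
    (Y_continuous : ms_continuous Y)
    (Y_centered : centered Y)
    (f_density : spectral_density Y f)
    (f_pd : forall l : R, pdmx (f l))
    (f_coherence : exists2 eps : R, 0 < eps < 1 &
       {ae lebesgue_measure, forall l : R, forall A B : {set 'I_k},
          A != finset.set0 -> B != finset.set0 -> [disjoint A & B] ->
          loewner_le (coherencemx (f l) A B) ((1 - eps)%:C)%:M})
    (Y_pnd : purely_nondeterministic Y) :
  let PC := partial_correlation_graph Y in
  let GC := causality_graph Y in
  (forall a b : 'I_k, a != b ->
     [<-> ~~ augmented GC a b;
          Dis GC (a |: children GC a) :&: Dis GC (b |: children GC b)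
            = finset.set0;
          separates (augmented GC) (~: [set a; b]) [set a] [set b]] /\
     (~~ augmented GC a b -> ~~ PC a b)) /\
  subrel PC (augmented GC).
Proof.
move=> PC GC.
have disE a b : a != b -> ~~ augmented GC a b ->
    Dis GC (a |: children GC a) :&: Dis GC (b |: children GC b) = finset.set0.
  by move=> ab; rewrite augmented_disE// negbK => /eqP.
have PC_sub a b : a != b -> ~~ augmented GC a b -> ~~ PC a b.
  move=> ab /(disE _ _ ab) D0; rewrite /PC /= ab negbK; apply/asboolP.
  have [eps /andP[eps0 _] coh] := f_coherence.
  apply: (separated_partial_uncorrelated Y_stationary Y_pnd f_density f_pd eps0).
    (* The coherence condition is specialized to [{a}] and its complement, which is nonempty because
       it contains [b]. *)
    have [N [mN N0 sub]] := coh; exists N; split=> // l; apply: contra_notP => Nl.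
    have := contrapT (fun H => Nl (sub l H)); apply.
    - by apply/set0Pn; exists a; rewrite inE.
    - by apply/set0Pn; exists b; rewrite !inE eq_sym.
    - by rewrite finset.disjoints_subset finset.setCK.
  apply/classical_sets.seteqP; split=> // v [/= va vb].
  by move: D0 => /setP/(_ v); rewrite !inE va vb.
split=> [a b ab|a b]; last first.
  have [->|ab] := eqVneq a b; first by rewrite uedge_irr.
  by apply: contraTT; exact: PC_sub.
split; last exact: PC_sub.
tfae.
- exact: disE.
- by move=> D0; apply/separates_rest => //; rewrite augmented_disE// D0 eqxx.
- by move=> /(separates_rest _ ab).
Qed.
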